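(* Let $\sigma\in(0,1)$ be fixed, let $\Omega\subset\mathbb{R}^N$ be a bounded domain with $C^2$ boundary and let $f\in C(\bar\Omega)$. For $\epsilon\in(0,1)$, let $u_\epsilon$ be a solution to the problem $$-\mathcal{I}_\epsilon[u]=f\ \text{ in }\Omega,\qquad u=0\ \text{ in }\Omega^c .$$ Then there is a modulus of continuity $m$, depending only on $f$ (in particular, not on $\epsilon\in(0,1)$), such that $$|u_\epsilon(x)-u_\epsilon(y)|\le m(|x-y|)\qquad\text{for all } x,y\in\Omega .$$
   Context: The number $\sigma\in(0,1)$ is fixed throughout; the datum $f:\bar\Omega\to\mathbb{R}$ carries its domain $\bar\Omega\subset\mathbb{R}^N$. For $\epsilon\in(0,1)$, $$K_\epsilon(z)=\frac{1}{\epsilon^{N+2\sigma}+|z|^{N+2\sigma}},\qquad \mathcal{I}_\epsilon[u](x)=\int_{\mathbb{R}^N}[u(x+z)-u(x)]K_\epsilon(z)\,dz .$$ A solution of the problem is a bounded function $u:\mathbb{R}^N\to\mathbb{R}$, continuous in $\Omega$, satisfying $-\mathcal{I}_\epsilon[u](x)=f(x)$ pointwise for every $x\in\Omega$ and $u=0$ on $\Omega^c=\mathbb{R}^N\setminus\Omega$ (no continuity across $\partial\Omega$ is required). A modulus of continuity is a nondecreasing function $m:[0,\infty)\to[0,\infty)$ with $m(0)=0$ and $m(t)\to0$ as $t\to0^+$. *)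

(* Defs.v *)
From HB Require Import structures.
From mathcomp Require Import all_boot all_order all_algebra.
From mathcomp Require Import all_classical all_reals all_analysis.

Set Implicit Arguments.
Unset Strict Implicit.
Unset Printing Implicit Defensive.

Import Order.TTheory GRing.Theory Num.Theory.
Import numFieldNormedType.Exports.

Local Open Scope classical_set_scope.
Local Open Scope ring_scope.

(* The library's norm on 'rV[R]_n is the sup norm; its topology is the usual
   one, but |z| in the kernel and |x - y| in the conclusion are Euclidean. *)
Definition enorm (R : realType) (n : nat) (x : 'rV[R]_n) : R :=
  Num.sqrt (\sum_(i < n) x 0 i ^+ 2).

Definition rV_display : measure_display.
Proof. exact. Qed.

(* The product sigma-algebra on R^n, that is, its Borel sigma-algebra. *)
Section measurable_rV.
Context {R : realType} {n : nat}.

Let coors : 'I_n -> 'rV[R]_n -> measurableTypeR R := fun i x => x 0 i.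

Let rV_set0 : g_sigma_preimage coors set0.
Proof. exact: sigma_algebra0. Qed.

Let rV_setC A : g_sigma_preimage coors A -> g_sigma_preimage coors (~` A).
Proof. exact: sigma_algebraC. Qed.

Let rV_bigcup (F : (set 'rV[R]_n)^nat) :
  (forall i, g_sigma_preimage coors (F i)) ->
  g_sigma_preimage coors (\bigcup_i (F i)).
Proof. exact: sigma_algebra_bigcup. Qed.

HB.instance Definition _ := @isMeasurable.Build rV_display
  'rV[R]_n (g_sigma_preimage coors) rV_set0 rV_setC rV_bigcup.

End measurable_rV.

Section rV_measurability.
Context {R : realType}.

Lemma measurable_coord n (i : 'I_n) :
  measurable_fun [set: 'rV[R]_n] (fun x => x 0 i : measurableTypeR R).
Proof.
move=> _ Y mY; rewrite setTI; apply: sub_sigma_algebra => /=.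
rewrite -bigcup_seq/=; exists i => /=; first by rewrite mem_index_enum.
by exists Y => //; rewrite setTI.
Qed.

Lemma measurable_fun_coordP d (T : measurableType d) n (f : T -> 'rV[R]_n) :
  measurable_fun [set: T] f <->
  forall i, measurable_fun [set: T] (fun t => f t 0 i : measurableTypeR R).
Proof.
split=> [mf i|mf].
  exact: (measurableT_comp (measurable_coord i) mf).
move=> _ A mA; rewrite setTI.
pose G : set (set 'rV[R]_n) := [set B | measurable (f @^-1` B)].
suff : @measurable _ 'rV[R]_n `<=` G by exact.
apply: smallest_sub.
  split=> [|B|F].
  - by rewrite /G /= preimage_set0; exact: measurable0.
  - by rewrite /G /= setTD preimage_setC => ?; exact: measurableC.
  - by rewrite /G /= preimage_bigcup => ?; exact: bigcup_measurable.
move=> B; rewrite -bigcup_seq/= => -[i _ [C mC <-]].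
rewrite /G /= setTI -comp_preimage.
by have := mf i measurableT C mC; rewrite setTI.
Qed.

Definition rV_cons n (p : measurableTypeR R * 'rV[R]_n) : 'rV[R]_n.+1 :=
  row_mx (p.1)%:M p.2.

Lemma rV_cons0 n p : @rV_cons n p 0 ord0 = p.1.
Proof.
transitivity (rV_cons p 0 (lshift n (@ord0 0))).
  by congr (fun_of_matrix _ _ _); exact/val_inj.
by apply: etrans (row_mxEl _ _ _ _) _; rewrite mxE.
Qed.

Lemma rV_consS n p (i : 'I_n) : @rV_cons n p 0 (lift ord0 i) = p.2 0 i.
Proof.
transitivity (rV_cons p 0 (rshift 1 i)).
  by congr (fun_of_matrix _ _ _); exact/val_inj.
exact: row_mxEr.
Qed.

Lemma measurable_rV_cons n :
  measurable_fun [set: measurableTypeR R * 'rV[R]_n] (@rV_cons n).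
Proof.
apply/measurable_fun_coordP => i.
case: (unliftP ord0 i) => [j ->|->].
  apply: (eq_measurable_fun (fun p : measurableTypeR R * 'rV[R]_n => p.2 0 j)).
    by move=> p _; rewrite rV_consS.
  exact: (measurableT_comp (measurable_coord j) measurable_snd).
apply: (eq_measurable_fun (fun p : measurableTypeR R * 'rV[R]_n => p.1)).
  by move=> p _; rewrite rV_cons0.
exact: measurable_fst.
Qed.

Definition rV_uncons n (x : 'rV[R]_n.+1) : measurableTypeR R * 'rV[R]_n :=
  (x 0 ord0, \row_i x 0 (lift ord0 i)).

Lemma rV_consK n : cancel (@rV_cons n) (@rV_uncons n).
Proof.
move=> p; rewrite [RHS]surjective_pairing /rV_uncons rV_cons0; congr pair.
by apply/rowP => i; rewrite mxE rV_consS.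
Qed.

Lemma measurable_rV_uncons n :
  measurable_fun [set: 'rV[R]_n.+1] (@rV_uncons n).
Proof.
apply/measurable_fun_pair; first exact: measurable_coord.
apply/measurable_fun_coordP => i.
apply: (eq_measurable_fun
    (fun x : 'rV[R]_n.+1 => x 0 (lift ord0 i) : measurableTypeR R)).
  by move=> x _; rewrite mxE.
exact: measurable_coord.
Qed.

End rV_measurability.

(* Lebesgue measure on R^n as the iterated product of the one on R; its value
   on boxes is computed in lebesgue_rV_box. *)
Fixpoint lebesgue_rV (R : realType) (n : nat) : set 'rV[R]_n -> \bar R :=
  if n is m.+1 then
    pushforward (@lebesgue_measure R \x @lebesgue_rV R m)%E (@rV_cons R m)
  else \d_(0 : 'rV[R]_0).

Section lebesgue_rV_measure.
Context {R : realType}.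

Lemma sigma_finite_measure_pack d (T : measurableType d)
    (m : {measure set T -> \bar R}) : sigma_finite setT m ->
  exists mu : {sigma_finite_measure set T -> \bar R},
    m = mu :> (set T -> \bar R).
Proof.
move=> m_sigma; pose f : set T -> \bar R := m.
pose fM := isMeasure.Build _ _ _ f (measure0 m) (measure_ge0 m)
  (@measure_semi_sigma_additive _ _ _ m).
pose fm : {measure set T -> \bar R} := HB.pack f fM.
pose fS := Measure_isSigmaFinite.Build _ _ _ (Measure.sort fm) m_sigma.
pose mu : {sigma_finite_measure set T -> \bar R} := HB.pack f fM fS.
by exists mu.
Qed.

Lemma lebesgue_rV_sigma_finite_measure n :
  exists mu : {sigma_finite_measure set 'rV[R]_n -> \bar R},
    @lebesgue_rV R n = mu :> (set 'rV[R]_n -> \bar R).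
Proof.
elim: n => [|n [mu mE]]; first by exists \d_(0 : 'rV[R]_0).
pose prod := (@lebesgue_measure R \x mu)%E.
have prod_sigma : sigma_finite setT prod.
  have /sigma_finiteP[F [TF ndF Foo]] := sigma_finiteT (@lebesgue_measure R).
  have /sigma_finiteP[G [TG ndG Goo]] := sigma_finiteT mu.
  exists (fun k => F k `*` G k).
    rewrite -setXTT TF TG predeqE => -[x y]; split.
      move=> [/= [k _ Fkx] [l _ Gly]]; exists (maxn k l) => //; split.
      - by move: x Fkx; exact/subsetPset/ndF/leq_maxl.
      - by move: y Gly; exact/subsetPset/ndG/leq_maxr.
    by move=> [k _ []/= ? ?]; split; exists k.
  move=> k; have [mFk Fk] := Foo k; have [mGk Gk] := Goo k.
  split; first exact: measurableX.
  by rewrite /prod product_measure1E// lte_mul_pinfty// ge0_fin_numE.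
pose nu := pushforward prod (@rV_cons R n).
have nu_sigma : sigma_finite setT nu.
  have [F FT mF] := prod_sigma.
  exists (fun k => @rV_uncons R n @^-1` F k).
    by rewrite -preimage_bigcup -FT preimage_setT.
  move=> k; have [mFk Fk] := mF k; split.
    by rewrite -[X in measurable X]setTI; exact: measurable_rV_uncons.
  rewrite /nu /pushforward -comp_preimage (_ : _ \o _ = id) ?preimage_id//.
  by apply/funext => p /=; rewrite rV_consK.
pose nuM : {measure set 'rV[R]_n.+1 -> \bar R} :=
  measure_function_pushforward__canonical__measure_function_Measure
    prod (@measurable_rV_cons R n).
have [nu' nuE] := sigma_finite_measure_pack (m := nuM) nu_sigma.
by exists nu'; rewrite -nuE /= mE.
Qed.

Let lebesgue_rV0 n : @lebesgue_rV R n set0 = 0%E.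
Proof. by have [mu ->] := lebesgue_rV_sigma_finite_measure n. Qed.

Let lebesgue_rV_ge0 n A : (0 <= @lebesgue_rV R n A)%E.
Proof. by have [mu ->] := lebesgue_rV_sigma_finite_measure n. Qed.

Let lebesgue_rV_semi_sigma_additive n : semi_sigma_additive (@lebesgue_rV R n).
Proof.
have [mu ->] := lebesgue_rV_sigma_finite_measure n.
exact: measure_semi_sigma_additive.
Qed.

HB.instance Definition _ n := isMeasure.Build _ _ _ (@lebesgue_rV R n)
  (@lebesgue_rV0 n) (@lebesgue_rV_ge0 n) (@lebesgue_rV_semi_sigma_additive n).

Let lebesgue_rV_sigma_finite n : sigma_finite setT (@lebesgue_rV R n).
Proof.
by have [mu ->] := lebesgue_rV_sigma_finite_measure n; exact: sigma_finiteT.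
Qed.

HB.instance Definition _ n := Measure_isSigmaFinite.Build _ _ _
  (@lebesgue_rV R n) (@lebesgue_rV_sigma_finite n).

Lemma lebesgue_rV_box n (A : 'I_n -> set (measurableTypeR R)) :
  (forall i, measurable (A i)) ->
  @lebesgue_rV R n [set x : 'rV[R]_n | forall i, A i (x 0 i)] =
  (\prod_(i < n) lebesgue_measure (A i))%E.
Proof.
elim: n A => [|n IH] A mA.
  by rewrite big_ord0 /= diracE mem_set// => -[].
pose B := [set x : 'rV[R]_n | forall i, A (lift ord0 i) (x 0 i)].
have mB : measurable B.
  rewrite (_ : B = \bigcap_(i in [set: 'I_n])
      (fun x : 'rV[R]_n => x 0 i : measurableTypeR R) @^-1` A (lift ord0 i)).
    apply: fin_bigcap_measurable => // i _.
    by rewrite -[X in measurable X]setTI; exact: measurable_coord.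
  by apply/seteqP; split=> x /= Bx i => [_|]; exact: Bx.
rewrite big_ord_recl -IH; last by move=> i; exact: mA.
rewrite -/B -(product_measure1E (@lebesgue_measure R) _ (mA ord0) mB) /=.
rewrite /pushforward.
congr (_ _); apply/seteqP; split=> p /=.
  move=> Ap; split; first by rewrite -(rV_cons0 p); exact: Ap.
  by move=> i; rewrite -(rV_consS p); exact: Ap.
move=> [Ap0 ApS] i; case: (unliftP ord0 i) => [j ->|->].
  by rewrite rV_consS; exact: ApS.
by rewrite rV_cons0.
Qed.

End lebesgue_rV_measure.

Fixpoint Ck (R : realType) (k n : nat) (g : 'rV[R]_n -> R) : Prop :=
  continuous g /\
  if k is k'.+1 then
    forall i : 'I_n, (forall x, derivable g x (delta_mx 0 i)) /\
                     Ck k' (fun x => 'D_(delta_mx 0 i) g x)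
  else True.

Definition bounded_domain (R : realType) (N : nat) (Omega : set 'rV[R]_N) :=
  [/\ open Omega, connected Omega, Omega !=set0 & bounded_set Omega].

(* Up to relabelling and reversing the coordinate axes (the choice of i and s),
   Omega is locally the strict supergraph of a C^2 function of the other N - 1
   coordinates; col' i x is x with its i-th coordinate removed. *)
Definition C2_boundary (R : realType) (N : nat) (Omega : set 'rV[R]_N) :=
  forall x0, (closure Omega `\` Omega°) x0 ->
  exists (i : 'I_N) (s : bool) (g : 'rV[R]_N.-1 -> R),
    Ck 2 g /\
    \forall x \near x0, Omega x <-> g (col' i x) < (-1) ^+ s * x 0 i.

Definition kernel_eps (R : realType) (N : nat) (sigma eps : R)
    (z : 'rV[R]_N) : R :=
  1 / (eps `^ (N%:R + 2 * sigma) + enorm z `^ (N%:R + 2 * sigma)).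

Definition I_eps (R : realType) (N : nat) (sigma eps : R) (u : 'rV[R]_N -> R)
    (x : 'rV[R]_N) : \bar R :=
  (\int[@lebesgue_rV R N]_z ((u (x + z) - u x) * kernel_eps sigma eps z)%:E)%E.

Definition is_solution (R : realType) (N : nat) (sigma eps : R)
    (Omega : set 'rV[R]_N) (f u : 'rV[R]_N -> R) :=
  [/\ bounded_fun u,
      {within Omega, continuous u},
      forall x, Omega x -> (- I_eps sigma eps u x)%E = (f x)%:E &
      forall x, ~ Omega x -> u x = 0].

(* Only the values of m on [0, +oo[ are constrained. *)
Definition modulus_of_continuity (R : realType) (m : R -> R) :=
  [/\ forall t : R, 0 <= t -> 0 <= m t,
      forall s t : R, 0 <= s -> s <= t -> m s <= m t,
      m 0 = 0 &
      m t @[t --> 0^'+] --> 0].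

(* Main.v *)
Require Import Defs.
From mathcomp Require Import all_boot all_order all_algebra.
From mathcomp Require Import all_classical all_reals all_analysis.
From mathcomp Require Import measurable_realfun ring lra.

Import Order.TTheory GRing.Theory Num.Theory.
Import numFieldNormedType.Exports.

Local Open Scope classical_set_scope.
Local Open Scope ring_scope.

Set Implicit Arguments.
Unset Strict Implicit.
Unset Printing Implicit Defensive.

(** Why the estimate is uniform in $\epsilon$.

    The operator has order zero for each fixed $\epsilon$, so the maximum
    principle needs neither attained maxima nor regularity: at a point where a
    bounded function is almost maximal the operator is almost bounded below by
    the excess over the exterior values, times the mass that the kernel puts
    outside a ball containing the domain ([max_principle]).  That mass is bounded
    below for $\epsilon\in(0,1)$ ([kernel_tail_mass_ge]), which gives at once a
    uniform bound on the solutions.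

    Solutions may jump at the boundary, and the jump only disappears as
    $\epsilon\to 0$.  Given a target oscillation $\eta$, two regimes are
    therefore separated by a threshold $\epsilon_0(\eta)$.

    For $\epsilon<\epsilon_0$ the solutions are at most $\eta/2$ in a boundary
    layer of fixed width.  At a boundary point $x_0$ the exterior of the domain
    has positive lower density because it contains boxes of every small size
    comparable to their distance to $x_0$ ([C2_boundary_exterior_box]).  A barrier
    at scale $r\ge\epsilon$ shows that a bound $T$ near $x_0$ improves to
    $(1-\theta)T$ in a smaller ball, with $\theta$ independent of the scale
    ([boundary_decay_step]); the scales are taken so small that the right-hand
    side and the tails are negligible against $r^{-2\sigma}$.  Iterating
    ([boundary_decay]) and using compactness of the boundary ([boundary_layer])
    yields the layer.  Since the operator commutes with translations,
    $u(\cdot+h)-u$ satisfies an equation whose right-hand side is the oscillation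
    of $f$, and the maximum principle propagates the smallness from the layer to
    the whole domain ([equicontinuity_small_eps]).

    For $\epsilon\ge\epsilon_0$ the equation expresses $u$ through $f$ and the
    convolution of $u$ with the kernel.  The kernel changes by a factor close to
    $1$ under small translations, uniformly in $\epsilon\ge\epsilon_0$
    ([kernel_shift_le]), so the convolution is equicontinuous
    ([equicontinuity_large_eps]).

    The modulus is the supremum of all oscillations of all solutions at distance
    at most $t$.  Balls and boxes are those of the sup norm; it is dominated by
    the Euclidean norm. *)

(** * Lebesgue measure on R^n *)

(** The product sigma-algebra contains the open sets because the boxes with
    rational centers and radii [1 / k.+1] form a countable base. *)
Lemma open_rV_measurable (R : realType) (n : nat) (U : set 'rV[R]_n) :
  open U -> measurable U.
Proof.
move=> oU.
pose B (q : 'rV[rat]_n * nat) : set 'rV[R]_n :=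
  [set x | forall i, `|x 0 i - ratr (q.1 0 i)| < q.2.+1%:R^-1].
have mB q : measurable (B q).
  rewrite (_ : B q = \bigcap_(i in [set: 'I_n])
      ((fun x : 'rV[R]_n => x 0 i : measurableTypeR R) @^-1`
         ball (ratr (q.1 0 i) : R) q.2.+1%:R^-1)).
    apply: fin_bigcap_measurable => // i _.
    rewrite -[X in measurable X]setTI; apply: measurable_coord => //.
    by rewrite ball_itv; exact: measurable_itv.
  by apply/seteqP; split=> x /= Bx i => [_|]; have := Bx i;
    rewrite /ball/= distrC; [|exact].
rewrite (_ : U = \bigcup_(q in [set q | B q `<=` U]) B q); last first.
  apply/seteqP; split=> [x Ux|x [q /= qU /qU]//].
  have /nbhs_ballP[e /= e0 eU] := open_nbhs_nbhs (conj oU Ux).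
  have [k ke] : exists k, k.+1%:R^-1 < e / 2.
    have [k _ /(_ k (leqnn k)) ke] :=
      near_infty_natSinv_lt (PosNum (divr_gt0 e0 (ltr0Sn R 1))).
    by exists k.
  have k0 : 0 < k.+1%:R^-1 :> R by [].
  have /choice[q qP] i : exists q : rat, `|x 0 i - ratr q| < k.+1%:R^-1.
    have [|q] := @rat_in_itvoo R (x 0 i) (x 0 i + k.+1%:R^-1); first by rewrite ltrDl.
    move=> xq; exists q.
    move: k0 xq; move: k.+1%:R^-1 => c c0.
    by rewrite in_itv/= ltr_distlC => /andP[? ?]; apply/andP; lra.
  exists (\row_i q i, k) => /=; last by move=> i; rewrite mxE.
  move=> y By; apply: eU; split => // i j; rewrite (ord1 i).
  have yq : `|y 0 j - ratr (q j)| < k.+1%:R^-1 by have := By j; rewrite /= mxE.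
  have xq := qP j; rewrite /ball/=; move: xq yq ke; move: k.+1%:R^-1 => c xq yq ke.
  rewrite (_ : x 0 j - y 0 j = (x 0 j - ratr (q j)) - (y 0 j - ratr (q j))).
    by rewrite (le_lt_trans (ler_normB _ _))//; lra.
  by rewrite opprB addrA subrK.
rewrite bigcup_mkcond; apply: countable_bigcupT_measurable.
  exact: countableP.
by move=> q; case: ifP.
Qed.

(** Measure-preserving maps of the line act coordinatewise on the iterated
    product: by induction, slicing along the first coordinate.  Translations and
    the reflection are the instances needed below. *)
Lemma lebesgue_rV_coordinatewise (R : realType) (n : nat)
    (t : 'I_n -> measurableTypeR R -> measurableTypeR R) :
  (forall i, measurable_fun setT (t i)) ->
  (forall i A, measurable A ->
    lebesgue_measure (t i @^-1` A) = lebesgue_measure A) ->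
  forall A, measurable A ->
  lebesgue_rV [set x : 'rV[R]_n | A (\row_i t i (x 0 i))] = lebesgue_rV A.
Proof.
elim: n t => [|n IH] t mt tE A mA.
  congr (lebesgue_rV _); apply/seteqP; split=> x /=;
    by rewrite (_ : \row_i t i (x 0 i) = x)//; apply/rowP; case.
have mcA : measurable (@rV_cons R n @^-1` A).
  by rewrite -[X in measurable X]setTI; exact: measurable_rV_cons.
rewrite /= /pushforward /product_measure1.
pose phi := (@lebesgue_rV R n) \o xsection (@rV_cons R n @^-1` A).
have mphi := measurable_fun_xsection (@lebesgue_rV R n) mcA.
transitivity (\int[lebesgue_measure]_x (phi \o t ord0) x)%E.
  apply: eq_integral => a _; rewrite /phi /=.
  rewrite -[RHS](IH (fun i => t (lift ord0 i)) (fun i => mt _) (fun i => tE _)); last first.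
    exact: measurable_xsection.
  congr (lebesgue_rV _); apply/seteqP; split=> y /=; rewrite /xsection /= !inE /=.
    move=> Ay; rewrite (_ : rV_cons _ = \row_i t i (rV_cons (a, y) 0 i))//.
    apply/rowP => i; rewrite [RHS]mxE; case: (unliftP ord0 i) => [j ->|->].
      by rewrite !rV_consS [LHS]mxE.
    by rewrite !rV_cons0.
  move=> Ay; rewrite (_ : \row_i _ = rV_cons (t ord0 a, \row_i t (lift ord0 i) (y 0 i)))//.
  apply/rowP => i; rewrite [LHS]mxE; case: (unliftP ord0 i) => [j ->|->].
    by rewrite !rV_consS [RHS]mxE.
  by rewrite !rV_cons0.
rewrite -[LHS](@ge0_integral_pushforward _ _ _ _ _ _ (mt ord0) _ setT)//.
by apply: eq_measure_integral => B mB _; rewrite -[RHS](tE ord0).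
Qed.

Lemma lebesgue_measure_translation (R : realType) (b : R)
    (A : set (measurableTypeR R)) : measurable A ->
  lebesgue_measure ((fun a => b + a : measurableTypeR R) @^-1` A) =
  lebesgue_measure A.
Proof.
move=> mA.
have mt : measurable_fun setT (fun a : measurableTypeR R => b + a : measurableTypeR R).
  exact: measurable_funD.
pose mu : {measure set (measurableTypeR R) -> \bar R} :=
  measure_function_pushforward__canonical__measure_function_Measure
    (@lebesgue_measure R) mt.
rewrite [RHS](lebesgue_measure_unique (mu := mu))// => _ [[c d]] _ <-.
rewrite /mu/= /pushforward.
rewrite (_ : _ @^-1` _ = `]c - b, d - b]%classic); last first.
  by apply/seteqP; split=> x /=; rewrite !in_itv/= => /andP[? ?]; apply/andP; lra.
rewrite !lebesgue_measure_itv/= !lte_fin ltrD2r.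
by rewrite -!EFinD; congr (if _ then _%:E else _); lra.
Qed.

Lemma lebesgue_rV_translation (R : realType) (n : nat) (b : 'rV[R]_n)
    (A : set 'rV[R]_n) : measurable A ->
  lebesgue_rV ((fun z => b + z) @^-1` A) = lebesgue_rV A.
Proof.
move=> mA; rewrite -[RHS](lebesgue_rV_coordinatewise (t := fun i a => b 0 i + a))//.
- congr (lebesgue_rV _); apply/funext => x /=; congr A.
  by apply/rowP => i; rewrite !mxE.
- by move=> i; exact: measurable_funD.
- by move=> i B mB; exact: lebesgue_measure_translation.
Qed.

Lemma lebesgue_rV_reflection (R : realType) (n : nat) (A : set 'rV[R]_n) :
  measurable A -> lebesgue_rV (-%R @^-1` A) = lebesgue_rV A.
Proof.
move=> mA; rewrite -[RHS](lebesgue_rV_coordinatewise (t := fun i a => - a))//.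
- congr (lebesgue_rV _); apply/funext => x /=; congr A.
  by apply/rowP => i; rewrite !mxE.
- by move=> i; exact: measurableT_comp.
- by move=> i B mB; exact: (lebesgue_measureN mB).
Qed.

Lemma measurable_fun_translation (R : realType) (n : nat) (b : 'rV[R]_n) :
  measurable_fun setT (fun z : 'rV[R]_n => b + z).
Proof.
apply/measurable_fun_coordP => i.
apply: (eq_measurable_fun (fun z : 'rV[R]_n => b 0 i + z 0 i : measurableTypeR R)).
  by move=> z _; rewrite mxE.
by apply: measurable_funD => //; exact: measurable_coord.
Qed.

Lemma measurable_fun_reflection (R : realType) (n : nat) :
  measurable_fun setT (-%R : 'rV[R]_n -> 'rV[R]_n).
Proof.
apply/measurable_fun_coordP => i.
apply: (eq_measurable_fun (fun z : 'rV[R]_n => - z 0 i : measurableTypeR R)).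
  by move=> z _; rewrite mxE.
by apply: measurableT_comp => //; exact: measurable_coord.
Qed.

Lemma Rintegral_measure_preserving (R : realType) (n : nat)
    (t : 'rV[R]_n -> 'rV[R]_n) (w : 'rV[R]_n -> R) :
  measurable_fun setT t ->
  (forall A, measurable A -> lebesgue_rV (t @^-1` A) = lebesgue_rV A) ->
  measurable_fun setT w ->
  (@lebesgue_rV R n).-integrable setT (EFin \o (w \o t)) ->
  \int[@lebesgue_rV R n]_z w (t z) = \int[@lebesgue_rV R n]_z w z.
Proof.
move=> mt tE mw iw; rewrite /Rintegral; congr fine.
rewrite -[LHS](integral_pushforward mt (D := setT) (f := EFin \o w))//.
- by apply: eq_measure_integral => A mA _; rewrite -[RHS](tE A).
- exact/measurable_EFinP.
Qed.

(** * The kernel and its truncated second moment *)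

Section norms.
Context {R : realType} {N : nat}.
Implicit Types z h : 'rV[R]_N.

Definition sqnorm z : R := \sum_(i < N) z 0 i ^+ 2.

Lemma sqnorm_ge0 z : 0 <= sqnorm z.
Proof. by apply: sumr_ge0 => i _; exact: sqr_ge0. Qed.

Lemma enorm_ge0 z : 0 <= enorm z.
Proof. exact: sqrtr_ge0. Qed.

Lemma enorm_sq z : enorm z ^+ 2 = sqnorm z.
Proof. by rewrite /enorm sqr_sqrtr// sqnorm_ge0. Qed.

Lemma coord_le_norm z i : `|z 0 i| <= `|z|.
Proof.
rewrite /Num.norm/= mx_normrE.
exact: (le_bigmax _ (fun ij : 'I_1 * 'I_N => `|z ij.1 ij.2|) (0, i)).
Qed.

Lemma norm_le_coord z (c : R) : 0 <= c -> (forall i, `|z 0 i| <= c) -> `|z| <= c.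
Proof.
move=> c0 zc; rewrite /Num.norm/= mx_normrE; apply/bigmax_leP; split => // -[j i] _.
by rewrite /= (ord1 j).
Qed.

Lemma norm_le_enorm z : `|z| <= enorm z.
Proof.
apply: norm_le_coord => [|i]; first exact: enorm_ge0.
rewrite -(@ler_pXn2r _ 2)//; last by rewrite nnegrE enorm_ge0.
rewrite enorm_sq real_normK ?num_real// /sqnorm (bigD1 i)//= lerDl.
by apply: sumr_ge0 => j _; exact: sqr_ge0.
Qed.

Lemma sqnorm_le z : sqnorm z <= N%:R * `|z| ^+ 2.
Proof.
rewrite -[N in N%:R]card_ord -sumr_const mulr_suml.
apply: ler_sum => i _; rewrite mul1r -[leLHS]real_normK ?num_real//.
by rewrite ler_sqr ?nnegrE// coord_le_norm.
Qed.

Lemma norm_sq_le z : `|z| ^+ 2 <= sqnorm z.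
Proof. by rewrite -enorm_sq ler_sqr ?nnegrE ?enorm_ge0// norm_le_enorm. Qed.

Lemma enorm_le z : enorm z <= N%:R * `|z|.
Proof.
rewrite -(@ler_pXn2r _ 2)//; [|by rewrite nnegrE enorm_ge0|by rewrite nnegrE mulr_ge0].
rewrite enorm_sq (le_trans (sqnorm_le z))// exprMn ler_wpM2r ?sqr_ge0//.
by rewrite -natrX ler_nat; case: (N) => // n; rewrite leq_pmulr.
Qed.

Lemma enormN z : enorm (- z) = enorm z.
Proof.
by rewrite /enorm; congr Num.sqrt; apply: eq_bigr => i _; rewrite mxE sqrrN.
Qed.

Lemma measurable_sqnorm : measurable_fun setT sqnorm.
Proof.
apply: measurable_sum => i; apply: measurable_funX; exact: measurable_coord.
Qed.

Lemma measurable_box (b : 'I_N -> R) (t : R) :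
  measurable [set z : 'rV[R]_N | forall i, `[b i, b i + t]%classic (z 0 i)].
Proof.
rewrite (_ : [set _ | _] = \bigcap_(i in [set: 'I_N])
    ((fun z : 'rV[R]_N => z 0 i : measurableTypeR R) @^-1` `[b i, b i + t]%classic)).
  apply: fin_bigcap_measurable => // i _; rewrite -[X in measurable X]setTI.
  exact: (measurable_coord i measurableT (measurable_itv `[b i, b i + t])).
by apply/seteqP; split=> z /= Bz i => [_|]; exact: Bz.
Qed.

Lemma lebesgue_box (b : 'I_N -> R) (t : R) : 0 <= t ->
  lebesgue_rV [set z : 'rV[R]_N | forall i, `[b i, b i + t]%classic (z 0 i)] =
  (t ^+ N)%:E.
Proof.
move=> t0.
rewrite (@lebesgue_rV_box _ _ (fun i => `[b i, b i + t]%classic)); last first.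
  by move=> i; exact: measurable_itv.
rewrite (eq_bigr (fun=> t%:E)); last first.
  move=> i _; rewrite lebesgue_measure_itv/= lte_fin.
  case: ifPn => [_|]; first by rewrite -EFinD; congr _%:E; lra.
  by rewrite -leNgt => tt; congr _%:E; lra.
by rewrite prodEFin prodr_const card_ord.
Qed.

Definition cube (t : R) : set 'rV[R]_N := [set z | `|z| <= t].

Lemma cubeE (t : R) : 0 <= t ->
  cube t = [set z : 'rV[R]_N | forall i, `[- t, - t + 2 * t]%classic (z 0 i)].
Proof.
have -> : - t + 2 * t = t by lra.
move=> t0; apply/seteqP; split=> z /= zt.
  by move=> i; rewrite in_itv/= -ler_norml (le_trans (coord_le_norm _ _)).
by apply: norm_le_coord => // i; have := zt i; rewrite in_itv/= -ler_norml.
Qed.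

Lemma lebesgue_cube (t : R) : 0 <= t ->
  lebesgue_rV (cube t) = ((2 * t) ^+ N)%:E.
Proof. by move=> t0; rewrite cubeE// lebesgue_box// mulr_ge0. Qed.

Lemma measurable_cube (t : R) : measurable (cube t).
Proof.
have [t0|t0] := leP 0 t; first by rewrite cubeE//; exact: measurable_box.
rewrite (_ : cube t = set0)//; apply/seteqP; split=> z //=.
by move=> /(le_trans (normr_ge0 z)); rewrite leNgt t0.
Qed.

End norms.

Lemma dyadic_bracket {R : realType} (t : R) : 1 <= t ->
  exists k, 2 ^+ k <= t <= 2 ^+ k.+1.
Proof.
move=> t1.
have ex : exists k, t <= 2 ^+ k.+1.
  exists (Num.truncn t).
  rewrite (le_trans (ltW (truncnS_gt t)))// -natrX ler_nat ltnW// ltn_expl//.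
exists (ex_minn ex); case: ex_minnP => -[|k] tk kmin; rewrite tk andbT//.
by rewrite leNgt; apply/negP => /ltW/kmin; rewrite ltnn.
Qed.

Lemma nneseries_geometric_le {R : realType} (a t : R) : 0 <= a -> 0 <= t < 1 ->
  (\sum_(k <oo) (a * t ^+ k)%:E <= (a / (1 - t))%:E)%E.
Proof.
move=> a0 /andP[t0 t1]; apply: lime_le.
  by apply: is_cvg_nneseries => k _ _; rewrite lee_fin mulr_ge0// exprn_ge0.
near=> n; rewrite sumEFin lee_fin.
have t_neq1 : t != 1 by rewrite lt_eqF.
have := geometric_seriesE a t_neq1 => /(congr1 (fun s => s n)).
rewrite /series/= => ->.
rewrite ler_pM2r ?invr_gt0 ?subr_gt0// -[leRHS]mulr1 ler_wpM2l//.
by rewrite gerBl exprn_ge0.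
Unshelve. all: by end_near. Qed.

Section kernel.
Context {R : realType} {N : nat} (sigma : R).
Hypothesis sigma01 : 0 < sigma < 1.
Local Notation p := (N%:R + 2 * sigma).
Local Notation mu := (@lebesgue_rV R N).
Local Notation K := (@kernel_eps R N sigma).
Implicit Types z h : 'rV[R]_N.

Let p_gt0 : 0 < p.
Proof. by have /andP[s0 _] := sigma01; rewrite ltr_wpDl// mulr_gt0. Qed.

Lemma kernel_gt0 eps z : 0 < eps -> 0 < K eps z.
Proof.
by move=> e0; rewrite /kernel_eps divr_gt0// ltr_pwDl ?powR_ge0 ?powR_gt0.
Qed.

Lemma kernelN eps z : K eps (- z) = K eps z.
Proof. by rewrite /kernel_eps enormN. Qed.

Lemma measurable_kernel_eps eps : 0 < eps -> measurable_fun setT (K eps).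
Proof.
move=> e0; rewrite (_ : K eps = fun z =>
    (eps `^ p + sqnorm z `^ (2^-1 * p)) `^ (-1)).
  have mD : measurable_fun setT
      (fun z : 'rV[R]_N => eps `^ p + sqnorm z `^ (2^-1 * p)).
    apply: measurable_funD => //.
    exact: (measurableT_comp (measurable_powR _) measurable_sqnorm).
  exact: (measurableT_comp (measurable_powR (-1)) mD).
apply/funext => z; rewrite /kernel_eps powR_inv1 ?addr_ge0 ?powR_ge0// div1r.
by rewrite powRrM powR12_sqrt// sqnorm_ge0.
Qed.

Lemma kernel_le eps z x : 0 < eps -> 0 < x -> x <= `|z| -> K eps z <= x `^ (- p).
Proof.
move=> e0 x0 xz; rewrite /kernel_eps powRN div1r lef_pV2 ?posrE ?powR_gt0//.
  rewrite (@le_trans _ _ (enorm z `^ p))//.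
    rewrite ge0_ler_powR ?(ltW p_gt0)// ?nnegrE ?(ltW x0) ?enorm_ge0//.
    exact: le_trans xz (norm_le_enorm z).
  by rewrite lerDr powR_ge0.
by rewrite ltr_pwDl ?powR_ge0 ?powR_gt0.
Qed.

Lemma kernel_ge eps z x : 0 < eps -> eps <= x -> enorm z <= x ->
  (2 * x `^ p)^-1 <= K eps z.
Proof.
move=> e0 ex zx; have x0 := lt_le_trans e0 ex.
rewrite /kernel_eps div1r lef_pV2 ?posrE ?mulr_gt0 ?powR_gt0//; last first.
  by rewrite ltr_pwDl ?powR_ge0 ?powR_gt0.
rewrite (_ : 2 * x `^ p = x `^ p + x `^ p); last by rewrite mulr_natl mulr2n.
by rewrite lerD// ge0_ler_powR ?(ltW p_gt0)// ?nnegrE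
  ?(ltW x0) ?(ltW e0) ?enorm_ge0.
Qed.

Lemma kernel_le_eps eps z : 0 < eps -> K eps z <= eps `^ (- p).
Proof.
move=> e0; rewrite /kernel_eps powRN div1r lef_pV2 ?posrE ?powR_gt0//.
  by rewrite lerDl powR_ge0.
by rewrite ltr_pwDl ?powR_ge0 ?powR_gt0.
Qed.

(** This one function controls both kinds of terms met at scale [r]: the second
    differences of the barriers, and the mass of the kernel beyond distance [r]. *)
Definition quad_cutoff (r : R) z : R := Num.min 1 (sqnorm z / r ^+ 2).

Lemma quad_cutoff_ge0 r z : 0 <= quad_cutoff r z.
Proof. by rewrite le_min ler01/= divr_ge0 ?sqr_ge0 ?sqnorm_ge0. Qed.

Lemma measurable_quad_cutoff r : measurable_fun setT (quad_cutoff r).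
Proof.
apply: measurable_minr => //; apply: measurable_funM => //.
exact: measurable_sqnorm.
Qed.

Let shell_mass x : 0 < x -> x `^ (- p) * (4 * x) ^+ N = 4 ^+ N * x `^ (- (2 * sigma)).
Proof.
move=> x0; rewrite exprMn mulrCA -[x ^+ N]powR_mulrn ?(ltW x0)// -powRD.
  by congr (_ * _ `^ _); lra.
by rewrite (gt_eqF x0) implybT.
Qed.

Let alpha : R := 2 `^ (2 * sigma).

Let alpha_gt1 : 1 < alpha.
Proof.
have /andP[s0 _] := sigma01.
rewrite /alpha -[X in X < _](congr1 (fun f => f (2 * sigma)) (powR1 R)).
by apply: gt0_ltr_powR; rewrite ?nnegrE//; lra.
Qed.

Let alpha_lt4 : alpha < 4.
Proof.
have /andP[_ s1] := sigma01.
have c1 : 1 < 2 `^ (2 - 2 * sigma).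
  rewrite -[X in X < _](congr1 (fun f => f (2 - 2 * sigma)) (powR1 R)).
  by apply: gt0_ltr_powR; rewrite ?nnegrE//; lra.
have <- : alpha * 2 `^ (2 - 2 * sigma) = 4.
  rewrite /alpha -powRD ?pnatr_eq0 ?implybT// addrC subrK.
  by rewrite (powR_mulrn 2)// -natrX.
by rewrite ltr_pMr//; have := alpha_gt1; lra.
Qed.

Let pow2_powR k : (2 ^+ k : R) `^ (2 * sigma) = alpha ^+ k.
Proof.
by rewrite -powR_mulrn// -powRrM mulrC powRrM powR_mulrn// powR_ge0.
Qed.

(** Against the limit kernel $|z|^{-N-2\sigma}$, which dominates [K] for every
    [eps], the quadratic behaviour at the origin is integrable because
    $\sigma<1$ and the tail because $\sigma>0$; the power of [r] is the
    scaling.  Both ranges are cut into dyadic shells, whose contributions form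
    geometric series of ratios [alpha / 4] and [alpha^-1]. *)
Lemma kernel_quad_cutoff_le : exists2 C : R, 0 < C &
  forall eps r, 0 < eps -> 0 < r ->
  (\int[mu]_z (quad_cutoff r z * K eps z)%:E <= (C * r `^ (- (2 * sigma)))%:E)%E.
Proof.
have a1 := alpha_gt1; have a4 := alpha_lt4.
have a0 : 0 < alpha by lra.
pose C0 := (1 - alpha^-1)^-1 + alpha / (1 - alpha / 4).
have b1 : alpha^-1 < 1 by rewrite invf_lt1//; lra.
have C00 : 0 < C0.
  by rewrite addr_gt0// ?invr_gt0 ?divr_gt0//; lra.
exists ((N%:R + 1) * 4 ^+ N * C0).
  by rewrite !mulr_gt0// ?exprn_gt0// ltr_wpDl.
move=> eps r e0 r0.
pose rs := r `^ (- (2 * sigma)).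
have rs0 : 0 < rs by rewrite powR_gt0.
pose x k : R := 2 ^+ k * r.
pose y k : R := r / 2 ^+ k.+1.
have x0 k : 0 < x k by rewrite mulr_gt0// exprn_gt0.
have y0 k : 0 < y k by rewrite divr_gt0// exprn_gt0.
have xs k : x k `^ (- (2 * sigma)) = rs * alpha^-1 ^+ k.
  rewrite /x powRM ?exprn_ge0 ?(ltW r0)// mulrC; congr (_ * _).
  by rewrite powRN pow2_powR exprVn.
have ys k : y k `^ (- (2 * sigma)) = rs * alpha ^+ k.+1.
  rewrite /y powRM ?invr_ge0 ?exprn_ge0 ?(ltW r0)//; congr (_ * _).
  rewrite powRN -pow2_powR -[(2 ^+ k.+1)^-1]powR_inv1 ?exprn_ge0//.
  by rewrite -powRrM mulN1r powRN invrK.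
pose A k (z : 'rV[R]_N) : R := (N%:R + 1) * x k `^ (- p) * \1_(cube (2 * x k)) z.
pose B k (z : 'rV[R]_N) : R :=
  (N%:R + 1) * ((2 ^- k) ^+ 2 * y k `^ (- p)) * \1_(cube (2 * y k)) z.
have n10 : 0 <= N%:R + 1 :> R by rewrite addr_ge0.
have A0 k z : 0 <= A k z by rewrite !mulr_ge0// ?powR_ge0.
have B0 k z : 0 <= B k z.
  by rewrite !mulr_ge0// ?powR_ge0// ?sqr_ge0 ?invr_ge0 ?exprn_ge0.
have mind t : measurable_fun setT (\1_(cube t) : 'rV[R]_N -> R).
  by apply: measurable_indic; exact: measurable_cube.
have mA k : measurable_fun setT (A k) by exact: measurable_funM.
have mB k : measurable_fun setT (B k) by exact: measurable_funM.
have pointwise z : ((quad_cutoff r z * K eps z)%:E <=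
    \sum_(k <oo) (A k z + B k z)%:E)%E.
  have AB0 k : (0 <= (A k z + B k z)%:E)%E by rewrite lee_fin addr_ge0.
  suff [k Hk] : exists k, quad_cutoff r z * K eps z <= A k z + B k z.
    apply: (@le_trans _ _ (\sum_(0 <= i < k.+1) (A i z + B i z)%:E)%E).
      rewrite big_nat_recr//= (@le_trans _ _ (A k z + B k z)%:E)//.
      by rewrite leeDr// sume_ge0.
    exact: nneseries_lim_ge.
  have K0 := ltW (kernel_gt0 z e0).
  have [z0|z0] := eqVneq `|z| 0.
    exists 0; rewrite (_ : quad_cutoff r z = 0) ?mul0r ?addr_ge0//.
    have q0 : sqnorm z = 0.
      apply/eqP; rewrite eq_le sqnorm_ge0 andbT (le_trans (sqnorm_le z))//.
      by rewrite z0 expr0n/= mulr0.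
    by apply/eqP; rewrite eq_le quad_cutoff_ge0 andbT /quad_cutoff q0 mul0r ge_min lexx orbT.
  have {}z0 : 0 < `|z| by rewrite lt_def z0 normr_ge0.
  have [rz|zr] := leP r `|z|.
    have [|k /andP[k1 k2]] := @dyadic_bracket _ (`|z| / r).
      by rewrite ler_pdivlMr// mul1r.
    have xz : x k <= `|z| by rewrite /x -ler_pdivlMr.
    have zx : `|z| <= 2 * x k.
      by rewrite /x mulrA -exprS -ler_pdivrMr.
    (* Outer shells: the cutoff is at most 1. *)
    exists k; rewrite (@le_trans _ _ (A k z)) ?lerDl// /A indicE mem_set// mulr1.
    rewrite ler_pM// ?quad_cutoff_ge0//.
      by rewrite (@le_trans _ _ 1) ?ge_min ?lexx// lerDr.
    exact: kernel_le.
  have [|k /andP[k1 k2]] := @dyadic_bracket _ (r / `|z|).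
    by rewrite ler_pdivlMr// mul1r ltW.
  have yz : y k <= `|z|.
    rewrite /y ler_pdivrMr ?exprn_gt0// mulrC.
    by move: k2; rewrite ler_pdivrMr.
  have zk : `|z| <= r * 2 ^- k.
    rewrite ler_pdivlMr ?exprn_gt0// mulrC.
    by move: k1; rewrite ler_pdivlMr.
  have zy : `|z| <= 2 * y k.
    by rewrite (le_trans zk)// /y exprS invfM mulrCA mulVKf//.
  (* Inner shells: the cutoff decays like the square of the shell radius. *)
  exists k; rewrite (@le_trans _ _ (B k z)) ?lerDr// /B indicE mem_set// mulr1.
  rewrite mulrA ler_pM// ?quad_cutoff_ge0//; last exact: kernel_le.
  rewrite (@le_trans _ _ (sqnorm z / r ^+ 2)) ?ge_min ?lexx ?orbT//.
  rewrite ler_pdivrMr ?exprn_gt0// -mulrA -exprMn (mulrC _ r).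
  rewrite (le_trans (sqnorm_le z))// ler_pM ?sqr_ge0//; first by rewrite lerDl.
  by rewrite ler_sqr ?nnegrE// (le_trans _ zk).
apply: (@le_trans _ _ (\int[mu]_z \sum_(k <oo) (A k z + B k z)%:E)%E).
  apply: ge0_le_integral => //.
  - by move=> z _; rewrite lee_fin mulr_ge0 ?quad_cutoff_ge0 ?(ltW (kernel_gt0 _ _)).
  - apply/measurable_EFinP; apply: measurable_funM.
      exact: measurable_quad_cutoff.
    exact: measurable_kernel_eps.
  - apply: ge0_emeasurable_sum => [k z _ _|k _].
      by rewrite lee_fin addr_ge0.
    by apply/measurable_EFinP; exact: measurable_funD.
rewrite integral_nneseries//; last 2 first.
- by move=> k; apply/measurable_EFinP; exact: measurable_funD.
- by move=> k z _; rewrite lee_fin addr_ge0.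
have intZ c t : 0 <= c -> 0 <= t ->
    (\int[mu]_z (c * \1_(cube t) z)%:E = (c * (2 * t) ^+ N)%:E)%E.
  move=> c0 t0; under eq_integral do rewrite EFinM.
  rewrite ge0_integralZl_EFin//; last exact/measurable_EFinP.
  rewrite integral_indic//; last exact: measurable_cube.
  by rewrite setIT EFinM; congr (_ * _)%E; exact: lebesgue_cube.
have -> : (\sum_(k <oo) \int[mu]_z (A k z + B k z)%:E =
   \sum_(k <oo) (((N%:R + 1) * 4 ^+ N * rs * alpha^-1 ^+ k)%:E +
     ((N%:R + 1) * 4 ^+ N * rs * alpha * (alpha / 4) ^+ k)%:E))%E.
  apply: eq_eseriesr => k _.
  under eq_integral do rewrite EFinD.
  rewrite ge0_integralD//; last 4 first.
  - by move=> z _; rewrite lee_fin.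
  - exact/measurable_EFinP.
  - by move=> z _; rewrite lee_fin.
  - exact/measurable_EFinP.
  rewrite !intZ//; last 4 first.
  - by rewrite !mulr_ge0// ?sqr_ge0// ?powR_ge0 ?invr_ge0 ?exprn_ge0.
  - by rewrite mulr_ge0// ltW.
  - by rewrite mulr_ge0// powR_ge0.
  - by rewrite mulr_ge0// ltW.
  move: (x k) (y k) (x0 k) (y0 k) (xs k) (ys k) => a b a_gt0 b_gt0 aE bE.
  have four c : 2 * (2 * c) = 4 * c :> R by rewrite mulrA; congr (_ * _); lra.
  rewrite !four; congr (_%:E + _%:E)%E.
    by rewrite -[LHS]mulrA shell_mass// aE !mulrA.
  rewrite -[LHS]mulrA -[X in _ * X]mulrA shell_mass// bE (exprS alpha) expr_div_n.
  rewrite (_ : (2 ^- k) ^+ 2 = (4 ^+ k)^-1 :> R); last first.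
    by rewrite exprVn -exprM mulnC exprM; congr ((_ ^+ k)^-1); lra.
  by ring.
rewrite nneseriesD//; last 2 first.
- by move=> k _ _; rewrite lee_fin !mulr_ge0 ?exprn_ge0 ?invr_ge0// ltW.
- by move=> k _ _; rewrite lee_fin !mulr_ge0 ?exprn_ge0 ?divr_ge0// ltW.
apply: le_trans.
  apply: leeD; apply: nneseries_geometric_le.
  - by rewrite !mulr_ge0 ?exprn_ge0// ltW.
  - by rewrite invr_ge0 (ltW a0).
  - by rewrite !mulr_ge0 ?exprn_ge0// ltW.
  - by apply/andP; split; [rewrite divr_ge0// ltW|rewrite ltr_pdivrMr// mul1r].
rewrite -EFinD lee_fin -/rs /C0 le_eqVlt; apply/orP; left; apply/eqP.
by move: (1 - alpha^-1)^-1 (1 - alpha / 4)^-1 (4 ^+ N) => c d e; ring.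
Qed.

End kernel.

(** * The nonlocal operator on bounded measurable functions *)

Lemma measurable_continuous_zero_ext (R : realType) (n : nat)
    (Omega : set 'rV[R]_n) (u : 'rV[R]_n -> R) :
  open Omega -> {within Omega, continuous u} ->
  (forall x, ~ Omega x -> u x = 0) -> measurable_fun setT u.
Proof.
move=> oO /continuousP cu u0.
apply: (measurability _ (RGenOpens.measurableE R)) => _ [_ [a [b ->] <-]].
have mO := open_rV_measurable oO.
have mI : measurable (Omega `&` u @^-1` `]a, b[%classic).
  by apply: open_rV_measurable; rewrite open_setSI//; apply: cu; exact: interval_open.
rewrite setTI; have [ab|ab] := pselect (`]a, b[%classic (0 : R)).
  rewrite (_ : _ @^-1` _ = (Omega `&` u @^-1` `]a, b[%classic) `|` ~` Omega).
    by apply: measurableU => //; exact: measurableC.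
  apply/seteqP; split=> x /=; last by case=> [[]//|/u0 ->].
  by move=> ux; have [Ox|Ox] := pselect (Omega x); [left|right].
rewrite (_ : _ @^-1` _ = Omega `&` u @^-1` `]a, b[%classic)//.
apply/seteqP; split=> x /=; last by case.
move=> ux; split => //; apply: contrapT => Ox; apply: ab.
by rewrite /= -(u0 _ Ox).
Qed.

Section bounded_measurable.
Context {R : realType} {N : nat}.
Implicit Types (w v : 'rV[R]_N -> R).

Definition bounded_measurable w :=
  measurable_fun setT w /\ exists C, forall z, `|w z| <= C.

Lemma bounded_measurable_cst c : bounded_measurable (fun=> c).
Proof. by split; [exact: measurable_cst|exists `|c|]. Qed.

Lemma bounded_measurableN w : bounded_measurable w ->
  bounded_measurable (fun z => - w z).
Proof.
move=> [mw [C wC]]; split; first exact: measurableT_comp.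
by exists C => z; rewrite normrN.
Qed.

Lemma bounded_measurableD w v : bounded_measurable w -> bounded_measurable v ->
  bounded_measurable (fun z => w z + v z).
Proof.
move=> [mw [C wC]] [mv [D vD]]; split; first exact: measurable_funD.
by exists (C + D) => z; rewrite (le_trans (ler_normD _ _))// lerD.
Qed.

Lemma bounded_measurableB w v : bounded_measurable w -> bounded_measurable v ->
  bounded_measurable (fun z => w z - v z).
Proof. by move=> bw bv; apply: bounded_measurableD => //; exact: bounded_measurableN. Qed.

Lemma bounded_measurableM w v : bounded_measurable w -> bounded_measurable v ->
  bounded_measurable (fun z => w z * v z).
Proof.
move=> [mw [C wC]] [mv [D vD]]; split; first exact: measurable_funM.
by exists (C * D) => z; rewrite normrM ler_pM.
Qed.

Lemma bounded_measurable_indic (A : set 'rV[R]_N) : measurable A ->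
  bounded_measurable \1_A.
Proof.
move=> mA; split; first exact: measurable_indic.
by exists 1 => z; rewrite indicE; case: (_ \in _); rewrite ?normr1 ?normr0.
Qed.

Lemma bounded_measurable_translation w b : bounded_measurable w ->
  bounded_measurable (fun z => w (b + z)).
Proof.
move=> [mw [C wC]]; split; last by exists C.
exact: (measurableT_comp mw (measurable_fun_translation b)).
Qed.

Lemma bounded_measurable_reflection w : bounded_measurable w ->
  bounded_measurable (fun z => w (- z)).
Proof.
move=> [mw [C wC]]; split; last by exists C.
exact: (measurableT_comp mw (@measurable_fun_reflection R N)).
Qed.

Lemma bounded_measurable_quad_cutoff r :
  bounded_measurable (@quad_cutoff R N r).
Proof.
split; first exact: measurable_quad_cutoff.
by exists 1 => z; rewrite ger0_norm ?quad_cutoff_ge0// ge_min lexx.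
Qed.

End bounded_measurable.

Section kernel_average.
Context {R : realType} {N : nat} (sigma : R).
Hypothesis sigma01 : 0 < sigma < 1.
Local Notation p := (N%:R + 2 * sigma).
Local Notation mu := (@lebesgue_rV R N).
Local Notation K := (@kernel_eps R N sigma).
Implicit Types (x z h : 'rV[R]_N) (w v u : 'rV[R]_N -> R).

Lemma kernel_integrable eps : 0 < eps -> mu.-integrable setT (EFin \o K eps).
Proof.
move=> e0; apply/integrableP; split.
  by apply/measurable_EFinP; exact: measurable_kernel_eps.
have [C C0 Cle] := kernel_quad_cutoff_le (N := N) sigma01.
have mind : measurable_fun setT (\1_(cube 1) : 'rV[R]_N -> R).
  by apply: measurable_indic; exact: measurable_cube.
have mqK : measurable_fun setT (fun z => quad_cutoff 1 z * K eps z).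
  apply: measurable_funM; first exact: measurable_quad_cutoff.
  exact: measurable_kernel_eps.
apply: (@le_lt_trans _ _ (\int[mu]_z
    ((eps `^ (- p) * \1_(cube 1) z)%:E + (quad_cutoff 1 z * K eps z)%:E))%E).
  apply: ge0_le_integral => //.
  - apply/measurable_EFinP; apply: measurableT_comp => //; exact: measurable_kernel_eps.
  - apply: emeasurable_funD; apply/measurable_EFinP => //; exact: measurable_funM.
  - move=> z _; rewrite /= -EFinD lee_fin gtr0_norm ?kernel_gt0//.
    have K0 := ltW (kernel_gt0 sigma z e0).
    rewrite indicE; have [z1|z1] := leP `|z| 1.
      rewrite mem_set// mulr1 (le_trans (kernel_le_eps sigma z e0))// lerDl.
      by rewrite mulr_ge0// quad_cutoff_ge0.
    rewrite memNset ?mulr0 ?add0r; last by apply/negP; rewrite -ltNge.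
    rewrite ler_peMl// le_min lexx/= expr1n divr1 (le_trans _ (norm_sq_le z))//.
    by rewrite exprn_ege1// ltW.
rewrite ge0_integralD//; last 4 first.
- by move=> z _; rewrite lee_fin mulr_ge0// powR_ge0.
- by apply/measurable_EFinP; exact: measurable_funM.
- by move=> z _; rewrite lee_fin mulr_ge0// ?quad_cutoff_ge0// ltW// kernel_gt0.
- exact/measurable_EFinP.
rewrite lte_add_pinfty//; last first.
  by apply: (le_lt_trans (Cle eps 1 e0 ltr01)); rewrite ltry.
under eq_integral do rewrite EFinM.
rewrite ge0_integralZl_EFin//; last 2 first.
- exact/measurable_EFinP.
- exact: powR_ge0.
rewrite integral_indic//; last exact: measurable_cube.
by rewrite setIT [X in (_ * X)%E](lebesgue_cube ler01) -EFinM ltry.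
Qed.

Definition kernel_avg eps w : R := \int[mu]_z (w z * K eps z).

Lemma bounded_measurable_integrable eps w : 0 < eps -> bounded_measurable w ->
  mu.-integrable setT (EFin \o (fun z => w z * K eps z)).
Proof.
move=> e0 [mw [C wC]].
have iCK : mu.-integrable setT (fun z => C%:E * (K eps z)%:E)%E.
  by apply: integrableZl => //; exact: kernel_integrable.
apply: le_integrable iCK => //.
  apply/measurable_EFinP; apply: measurable_funM => //; exact: measurable_kernel_eps.
move=> z _ /=; rewrite lee_fin !normrM ler_wpM2r//.
exact: le_trans (wC z) (ler_norm C).
Qed.

Lemma kernel_avgD eps w v : 0 < eps -> bounded_measurable w ->
  bounded_measurable v ->
  kernel_avg eps (fun z => w z + v z) = kernel_avg eps w + kernel_avg eps v.
Proof.
move=> e0 bw bv; rewrite /kernel_avg -RintegralD//; last 2 first.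
- exact: bounded_measurable_integrable.
- exact: bounded_measurable_integrable.
by apply: eq_Rintegral => z _; rewrite mulrDl.
Qed.

Lemma kernel_avgZ eps c w : 0 < eps -> bounded_measurable w ->
  kernel_avg eps (fun z => c * w z) = c * kernel_avg eps w.
Proof.
move=> e0 bw; rewrite /kernel_avg -RintegralZl//; last first.
  exact: bounded_measurable_integrable.
by apply: eq_Rintegral => z _; rewrite mulrA.
Qed.

Lemma kernel_avgN eps w : 0 < eps -> bounded_measurable w ->
  kernel_avg eps (fun z => - w z) = - kernel_avg eps w.
Proof.
move=> e0 bw; rewrite -mulN1r -kernel_avgZ//.
by apply: eq_Rintegral => z _; rewrite mulN1r.
Qed.

Lemma kernel_avgB eps w v : 0 < eps -> bounded_measurable w ->
  bounded_measurable v ->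
  kernel_avg eps (fun z => w z - v z) = kernel_avg eps w - kernel_avg eps v.
Proof.
move=> e0 bw bv; rewrite (kernel_avgD (v := fun z => - v z))// ?kernel_avgN//.
exact: bounded_measurableN.
Qed.

Lemma kernel_avg_le eps w v : 0 < eps -> bounded_measurable w ->
  bounded_measurable v -> (forall z, w z <= v z) ->
  kernel_avg eps w <= kernel_avg eps v.
Proof.
move=> e0 bw bv wv; apply: le_Rintegral => //.
- exact: bounded_measurable_integrable.
- exact: bounded_measurable_integrable.
- by move=> z _; rewrite ler_wpM2r// ltW// kernel_gt0.
Qed.

Lemma kernel_avg_ge0 eps w : 0 < eps -> (forall z, 0 <= w z) ->
  0 <= kernel_avg eps w.
Proof.
by move=> e0 w0; apply: Rintegral_ge0 => z _; rewrite mulr_ge0// ltW// kernel_gt0.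
Qed.

Lemma kernel_avg_reflection eps w : 0 < eps -> bounded_measurable w ->
  kernel_avg eps (fun z => w (- z)) = kernel_avg eps w.
Proof.
move=> e0 bw.
have mwK : measurable_fun setT (fun z => w z * K eps z).
  by apply: measurable_funM; [exact: bw.1|exact: measurable_kernel_eps].
have iwK : mu.-integrable setT
    (EFin \o ((fun z => w z * K eps z) \o (-%R : 'rV[R]_N -> 'rV[R]_N))).
  apply: eq_integrable (bounded_measurable_integrable e0
    (bounded_measurable_reflection bw)) => // z _ /=.
  by rewrite kernelN.
rewrite /kernel_avg -[RHS](Rintegral_measure_preserving
  (@measurable_fun_reflection R N) (@lebesgue_rV_reflection R N) mwK iwK).
by apply: eq_Rintegral => z _; rewrite kernelN.
Qed.

Lemma kernel_avg_indic_ge eps (A : set 'rV[R]_N) (c m : R) : 0 < eps ->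
  measurable A -> 0 <= c -> (forall z, A z -> c <= K eps z) ->
  (m%:E <= lebesgue_rV A)%E -> c * m <= kernel_avg eps \1_A.
Proof.
move=> e0 mA c0 cK mA_le; rewrite -lee_fin.
apply: (@le_trans _ _ (c%:E * lebesgue_rV A)%E).
  by rewrite EFinM lee_wpmul2l.
have -> : (c%:E * lebesgue_rV A = \int[mu]_z (c * \1_A z)%:E)%E.
  under eq_integral do rewrite EFinM.
  rewrite ge0_integralZl_EFin//; last first.
    by apply/measurable_EFinP; exact: measurable_indic.
  by rewrite integral_indic// setIT.
rewrite /kernel_avg /Rintegral fineK; last first.
  apply: integrable_fin_num => //.
  by apply: bounded_measurable_integrable => //; exact: bounded_measurable_indic.
apply: ge0_le_integral => //.
- by move=> z _; rewrite lee_fin mulr_ge0.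
- apply/measurable_EFinP; apply: measurable_funM => //; exact: measurable_indic.
- apply/measurable_EFinP; apply: measurable_funM; first exact: measurable_indic.
  exact: measurable_kernel_eps.
- move=> z _; rewrite lee_fin mulrC indicE; case: (boolP (z \in A)) => zA.
    by rewrite !mul1r cK//; exact: set_mem.
  by rewrite !mul0r.
Qed.

Lemma kernel_avg_quad_cutoff_le : exists2 C : R, 0 < C &
  forall eps r, 0 < eps -> 0 < r ->
  kernel_avg eps (quad_cutoff r) <= C * r `^ (- (2 * sigma)).
Proof.
have [C C0 Cle] := kernel_quad_cutoff_le (N := N) sigma01.
exists C => // eps r e0 r0; rewrite -lee_fin.
rewrite /kernel_avg /Rintegral fineK; first exact: Cle.
apply: integrable_fin_num => //; apply: bounded_measurable_integrable => //.
exact: bounded_measurable_quad_cutoff.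
Qed.

(** $-\mathcal{I}_\epsilon$, as a real-valued operator. *)
Definition nonlocal eps u x : R := kernel_avg eps (fun z => u x - u (x + z)).

Lemma bounded_measurable_increment u x : bounded_measurable u ->
  bounded_measurable (fun z => u x - u (x + z)).
Proof.
move=> bu; apply: bounded_measurableB; first exact: bounded_measurable_cst.
exact: bounded_measurable_translation.
Qed.

Lemma nonlocalB eps u v x : 0 < eps -> bounded_measurable u ->
  bounded_measurable v ->
  nonlocal eps (fun y => u y - v y) x = nonlocal eps u x - nonlocal eps v x.
Proof.
move=> e0 bu bv; rewrite /nonlocal -kernel_avgB//; last 2 first.
- exact: bounded_measurable_increment.
- exact: bounded_measurable_increment.
by apply: eq_Rintegral => z _; congr (_ * _); lra.
Qed.

Lemma nonlocalN eps u x : 0 < eps -> bounded_measurable u ->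
  nonlocal eps (fun y => - u y) x = - nonlocal eps u x.
Proof.
move=> e0 bu; rewrite /nonlocal -kernel_avgN//; last first.
  exact: bounded_measurable_increment.
by apply: eq_Rintegral => z _; congr (_ * _); lra.
Qed.

Lemma nonlocal_translation eps u b x :
  nonlocal eps (fun y => u (b + y)) x = nonlocal eps u (b + x).
Proof. by apply: eq_Rintegral => z _; rewrite addrA. Qed.

(** A maximum need not be attained, since [v] is not assumed continuous.  At a
    point [y] of [D] where [v] is within [t] of its supremum [S], every increment
    [v y - v (y + z)] is at least [- t], and at least [S - B - t] once [z] is so
    long that [y + z] has left [D].  Averaging against the kernel, of finite mass,
    and letting [t] tend to zero bounds [(S - B) * kappa] by [A]. *)
Lemma max_principle eps v (D : set 'rV[R]_N) (rho A B kappa : R) :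
  0 < eps -> bounded_measurable v ->
  (forall x, D x -> `|x| <= rho) -> (forall x, ~ D x -> v x <= B) ->
  (forall x, D x -> nonlocal eps v x <= A) -> 0 <= A ->
  0 < kappa -> kappa <= kernel_avg eps \1_(~` cube (2 * rho)) ->
  forall x, v x <= B + A / kappa.
Proof.
move=> e0 bv Drho vB vA A0 kappa0 kappaE.
have [mv [C vC]] := bv.
have Vsup : has_sup (range v).
  split; first by exists (v 0), 0.
  by exists C => _ [z _ <-]; exact: le_trans (ler_norm _) (vC z).
pose S := sup (range v).
have vS z : v z <= S by apply: sup_upper_bound => //; exists z.
move=> x; apply: le_trans (vS x) _; rewrite leNgt; apply/negP => SB.
have SB0 : B < S by rewrite (le_lt_trans _ SB)// lerDl divr_ge0// ltW.
suff : (S - B) * kappa <= A.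
  by rewrite -ler_pdivlMr// => ?; lra.
pose m1 := kernel_avg eps (fun=> 1).
have m10 : 0 <= m1 by exact: kernel_avg_ge0.
apply/ler_addgt0Pr => e e_gt0.
pose t := Num.min (S - B) (e / (m1 + 1)).
have t0 : 0 < t.
  by rewrite lt_min subr_gt0 SB0 divr_gt0//; lra.
have [_ [y _ <-] Sy] := sup_adherent t0 Vsup.
have tB : t <= S - B by rewrite ge_min lexx.
have te : t * m1 <= e.
  apply: (@le_trans _ _ (e / (m1 + 1) * (m1 + 1))).
    by rewrite ler_pM ?(ltW t0)// ?ge_min ?lexx ?orbT//; lra.
  by rewrite divfK//; lra.
have Dy : D y.
  by apply: contrapT => /vB; rewrite leNgt; apply/negP; rewrite negbK -/S in Sy *; lra.
have mC : measurable (~` cube (2 * rho) : set 'rV[R]_N).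
  by apply: measurableC; exact: measurable_cube.
have b1 := bounded_measurable_indic mC.
have bc c := @bounded_measurable_cst R N c.
have : kernel_avg eps (fun z => (S - B) * \1_(~` cube (2 * rho)) z - t * 1) <=
    nonlocal eps v y.
  apply: kernel_avg_le => //.
  - apply: bounded_measurableB => //; apply: bounded_measurableM => //.
  - exact: bounded_measurable_increment.
  - move=> z; rewrite mulr1 indicE.
    have Sy' : S - t < v y by [].
    case: (boolP (z \in _)) => [|_]; last first.
      by rewrite mulr0; have := vS (y + z); lra.
    rewrite inE => /negP; rewrite -ltNge => zrho.
    rewrite mulr1; suff : v (y + z) <= B by lra.
    apply: vB => /Drho yzrho.
    have := Drho _ Dy; have := ler_normB (y + z) y.
    by rewrite addrAC subrr add0r; lra.
rewrite kernel_avgB// ?kernel_avgZ//; [|exact: bounded_measurableM..].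
rewrite -/m1 => H; have := vA _ Dy.
have : (S - B) * kappa <= (S - B) * kernel_avg eps \1_(~` cube (2 * rho)).
  by rewrite ler_wpM2l//; lra.
lra.
Qed.

(** A cube at distance comparable to [rho] already carries enough mass, and on
    it the kernel is bounded below uniformly in [eps < 1].  This makes the
    constant in [max_principle] independent of [eps]. *)
Lemma kernel_tail_mass_ge (hN : (0 < N)%N) (rho : R) : 0 < rho ->
  exists2 kappa : R, 0 < kappa & forall eps, 0 < eps < 1 ->
    kappa <= kernel_avg eps \1_(~` cube (2 * rho)).
Proof.
move=> rho0.
pose Q := [set z : 'rV[R]_N | forall i, `[3 * rho, 3 * rho + rho]%classic (z 0 i)].
have QE : lebesgue_rV Q = (rho ^+ N)%:E by apply: lebesgue_box; exact: ltW.
have mQ : measurable Q by exact: measurable_box.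
pose x := N%:R * (4 * rho) + 1.
have x1 : 1 <= x by rewrite lerDr mulr_ge0// mulr_ge0// ltW.
have x0 : 0 < x by lra.
have c0 : 0 < (2 * x `^ p)^-1 by rewrite invr_gt0 mulr_gt0// powR_gt0.
exists ((2 * x `^ p)^-1 * rho ^+ N); first by rewrite mulr_gt0// exprn_gt0.
move=> eps /andP[e0 e1].
apply: (@le_trans _ _ (kernel_avg eps \1_Q)).
  apply: kernel_avg_indic_ge => //; rewrite ?QE//; first exact: ltW.
  move=> z Qz; apply: kernel_ge => //; first by lra.
  rewrite (le_trans (enorm_le z))// (@le_trans _ _ (N%:R * (4 * rho)))//.
    rewrite ler_wpM2l//; apply: norm_le_coord; first by lra.
    move=> i; have := Qz i; rewrite /= in_itv/= => /andP[? ?].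
    by rewrite ger0_norm//; lra.
  by rewrite /x; lra.
have mC : measurable (~` cube (2 * rho) : set 'rV[R]_N).
  by apply: measurableC; exact: measurable_cube.
apply: kernel_avg_le => //; try exact: bounded_measurable_indic.
move=> z; rewrite !indicE; case: (boolP (z \in Q)) => // zQ.
rewrite mem_set//; apply/negP; rewrite -ltNge.
move: zQ; rewrite inE => /(_ (Ordinal hN)); rewrite /= in_itv/= => /andP[z3 _].
by have := coord_le_norm z (Ordinal hN); have := ler_norm (z 0 (Ordinal hN)); lra.
Qed.

End kernel_average.

(** * Exterior boxes at boundary points *)

Section line_derivative.
Context {R : realType} {n : nat} (g : 'rV[R]_n -> R).

Lemma is_derive_line (w v : 'rV[R]_n) (t : R) :
  derivable g (t *: v + w) v ->
  is_derive t 1 (fun s => g (s *: v + w)) ('D_v g (t *: v + w)).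
Proof.
have E : (fun h : R => h^-1 *: (g ((h *: 1 + t) *: v + w) - g (t *: v + w))) =
    (fun h : R => h^-1 *: (g (h *: v + (t *: v + w)) - g (t *: v + w))).
  by apply/funext => h; rewrite scalerDl addrA [h *: 1]mulr1.
move=> dg; split; first by rewrite /derivable /= E.
by rewrite /derive /= E.
Qed.

Lemma line_increment_le (w v : 'rV[R]_n) (t M : R) :
  (forall x, derivable g x v) ->
  (forall s, `|s| <= `|t| -> `|'D_v g (s *: v + w)| <= M) ->
  `|g (t *: v + w) - g w| <= M * `|t|.
Proof.
move=> dg DM.
have dphi (s : R) : is_derive s (1 : R) (fun s : R => g (s *: v + w)) ('D_v g (s *: v + w)).
  exact: is_derive_line.
have cphi (a b : R) : {within `[a, b], continuous (fun s => g (s *: v + w))}.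
  apply: derivable_within_continuous => s _; exact: ex_derive.
have M_mvt a b : a <= b -> (forall s, s \in `[a, b] -> `|s| <= `|t|) ->
    `|g (b *: v + w) - g (a *: v + w)| <= M * (b - a).
  move=> ab st.
  have [c cab ->] := MVT_segment ab (fun s _ => dphi s) (cphi a b).
  rewrite normrM (ger0_norm (x := b - a)) ?subr_ge0//.
  by rewrite ler_wpM2r ?subr_ge0//; apply: DM; exact: st.
have [t0|/ltW t0] := leP 0 t.
  have := M_mvt _ _ t0; rewrite scale0r add0r subr0 (ger0_norm t0); apply.
  by move=> s; rewrite in_itv/= => /andP[s0 s1]; rewrite ger0_norm.
have := M_mvt _ _ t0; rewrite scale0r add0r sub0r (ler0_norm t0) distrC; apply.
by move=> s; rewrite in_itv/= => /andP[s0 s1]; rewrite ler0_norm// lerN2.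
Qed.

(** Changing the coordinates one at a time, each increment is controlled by a
    partial derivative, which is bounded near [a] by continuity. *)
Lemma Ck1_lipschitz_at (k : nat) (a : 'rV[R]_n) : Ck k.+1 g ->
  exists2 L : R, 1 <= L & \forall y \near a, `|g y - g a| <= L * `|y - a|.
Proof.
move=> [_ dg].
have Dnear : \forall x \near a, forall j : 'I_n,
    `|'D_(delta_mx 0 j) g x| <= `|'D_(delta_mx 0 j) g a| + 1.
  apply: (@filter_forall _ _ (fun j x => `|'D_(delta_mx 0 j) g x| <=
    `|'D_(delta_mx 0 j) g a| + 1) (nbhs a)) => j.
  have cD : {for a, continuous (fun x => 'D_(delta_mx 0 j) g x)}.
    by have [_ C] := dg j; clear dg; case: k C => [[C _]|k [C _]]; exact: C.
  by apply: cvgr_norm_le; [exact: cD|rewrite ltrDl].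
pose M := \sum_(j < n) (`|'D_(delta_mx 0 j) g a| + 1).
have M0 : 0 <= M by apply: sumr_ge0 => j _; rewrite addr_ge0.
exists (n%:R * M + 1); first by rewrite lerDr mulr_ge0.
have /nbhs_ballP[d /= d0 aD] := Dnear.
near=> y.
have ya : `|y - a| < d.
  have : ball a d y by near: y; exact: nbhsx_ballx.
  by rewrite -ball_normE /= distrC.
pose w i : 'rV[R]_n := \row_j (if (j < i)%N then y 0 j else a 0 j).
have step i : (i <= n)%N -> `|g (w i) - g a| <= i%:R * (M * `|y - a|).
  elim: i => [_|i IH ilt].
    rewrite (_ : w 0 = a) ?subrr ?normr0 ?mul0r//.
    by apply/rowP => j; rewrite mxE.
  pose j := Ordinal ilt.
  have wS : w i.+1 = (y 0 j - a 0 j) *: delta_mx 0 j + w i.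
    apply/rowP => l; rewrite !mxE eqxx/=.
    have [->|lj] := eqVneq l j; first by rewrite /= ltnSn ltnn mulr1 subrK.
    rewrite mulr0 add0r ltnS leq_eqVlt.
    by rewrite (_ : (l == i :> nat) = false)//; apply/negbTE; rewrite -val_eqE in lj.
  have -> : g (w i.+1) - g a = (g (w i.+1) - g (w i)) + (g (w i) - g a).
    by rewrite addrA subrK.
  rewrite (le_trans (ler_normD _ _))// addrC -natr1 mulrDl mul1r.
  rewrite lerD ?IH ?(ltnW ilt)// wS.
  apply: (@le_trans _ _ (M * `|y 0 j - a 0 j|)); last first.
    by rewrite ler_wpM2l// (le_trans _ (coord_le_norm _ j))// !mxE.
  apply: line_increment_le => [x|s st]; first exact: (dg j).1.
  apply: (@le_trans _ _ (`|'D_(delta_mx 0 j) g a| + 1)).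
    apply: aD; rewrite -ball_normE /= -normrN opprB.
    apply: le_lt_trans ya; apply: norm_le_coord => // l.
    rewrite !mxE eqxx/=; have [->|lj] := eqVneq l j.
      rewrite /= ltnn mulr1 addrK (le_trans st)//.
      by rewrite (le_trans _ (coord_le_norm _ j))// !mxE.
    rewrite mulr0 add0r; case: ifPn => _; last by rewrite subrr normr0.
    by rewrite (le_trans _ (coord_le_norm _ l))// !mxE.
  by rewrite /M (bigD1 j)//= lerDl sumr_ge0// => l _; rewrite addr_ge0.
have := step n (leqnn n); rewrite (_ : w n = y); last first.
  by apply/rowP => j; rewrite mxE ltn_ord.
by move/le_trans; apply; rewrite mulrDl mul1r mulrA lerDl.
Unshelve. all: by end_near. Qed.

End line_derivative.

(** The defining function of the boundary is Lipschitz at the boundary point, so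
    a truncated cone with vertex [x0] lies outside [Omega]; it contains boxes
    of size comparable to their distance to [x0]. *)
Lemma C2_boundary_exterior_box (R : realType) (N : nat) (Omega : set 'rV[R]_N)
    (x0 : 'rV[R]_N) :
  open Omega -> C2_boundary Omega -> closure Omega x0 -> ~ Omega x0 ->
  exists c r0 : R, [/\ 0 < c, 0 < r0 & forall r, 0 < r < r0 ->
    exists Q : set 'rV[R]_N, [/\ measurable Q, Q `<=` ~` Omega,
      forall x, Q x -> `|x - x0| <= r &
      ((c * r ^+ N)%:E <= lebesgue_rV Q)%E]].
Proof.
move=> oO bO cx nx.
have [|i [s [g [Cg graph]]]] := bO x0.
  by split => //; rewrite (interior_id Omega).1.
have [L L1 glip] := Ck1_lipschitz_at (col' i x0) Cg.
have x0g : (-1) ^+ s * x0 0 i <= g (col' i x0).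
  by rewrite leNgt; apply/negP => /(nbhs_singleton graph).2.
have /nbhs_ballP[d /= d0 dlip] := glip.
have /nbhs_ballP[e /= e0 egraph] := graph.
have L0 : 0 < L + 1 by lra.
exists ((L + 1) ^- N), (Num.min e d); split.
- by rewrite invr_gt0 exprn_gt0.
- by rewrite lt_min e0 d0.
move=> r /andP[r0]; rewrite lt_min => /andP[re rd].
pose t := r / (L + 1).
have t0 : 0 < t by rewrite divr_gt0.
have tr : t * (L + 1) = r by rewrite /t divfK// gt_eqF.
have tLr : t + t * L = r by rewrite -tr; lra.
have tL0 : 0 < t * L by rewrite mulr_gt0//; lra.
(* The offset [t * L] in the graph direction puts the box below the cone of
   slope [L] with vertex [x0], hence outside of the supergraph. *)
pose b j := if j != i then x0 0 j else if s then x0 0 i + t * L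
  else x0 0 i - t * L - t.
pose Q := [set x : 'rV[R]_N | forall j, `[b j, b j + t]%classic (x 0 j)].
have Qr x : Q x -> `|x - x0| <= r.
  move=> Qx; apply: norm_le_coord => [|j]; first exact: ltW.
  have := Qx j; rewrite /= in_itv/= !mxE /b.
  have [->|_] := eqVneq j i; last by rewrite /= ler_norml => /andP[? ?]; lra.
  by case: (s) => /= /andP[? ?]; rewrite ler_norml; lra.
have Qt x : Q x -> `|col' i x - col' i x0| <= t.
  move=> Qx; apply: norm_le_coord => [|j]; first exact: ltW.
  rewrite !mxE; have := Qx (lift i j); rewrite /= in_itv/= /b.
  rewrite eq_sym (neq_lift i j) => /andP[? ?].
  by rewrite ler_norml; lra.
exists Q; split => //.
- exact: measurable_box.
- move=> x Qx; apply/(egraph x _).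
    by rewrite -ball_normE /= distrC (le_lt_trans (Qr _ Qx)).
  apply/negP; rewrite -leNgt.
  have xt := Qt _ Qx.
  have : `|g (col' i x) - g (col' i x0)| <= L * `|col' i x - col' i x0|.
    apply: dlip; rewrite -ball_normE /= distrC (le_lt_trans xt)//; lra.
  have : L * `|col' i x - col' i x0| <= L * t by rewrite ler_wpM2l//; lra.
  rewrite ler_norml => xtL /andP[gx _].
  have := Qx i; rewrite /= in_itv/= /b eqxx/=; move: x0g.
  by case: (s) => /=; rewrite ?expr1 ?expr0 => x0g /andP[? ?]; lra.
- rewrite lebesgue_box ?(ltW t0)// lee_fin le_eqVlt; apply/orP; left; apply/eqP.
  by rewrite /t expr_div_n mulrC.
Qed.

(** * Decay at the boundary *)

Section quad_cutoff_increment.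
Context {R : realType} {N : nat} (sigma : R).
Hypothesis sigma01 : 0 < sigma < 1.
Implicit Types x z : 'rV[R]_N.

Lemma quad_cutoff_le1 r z : quad_cutoff r z <= 1.
Proof. by rewrite ge_min lexx. Qed.

Lemma quad_cutoffE r z : 0 < r -> sqnorm z <= r ^+ 2 ->
  quad_cutoff r z = sqnorm z / r ^+ 2.
Proof.
by move=> r0 zr; rewrite /quad_cutoff min_r// ler_pdivrMr ?exprn_gt0// mul1r.
Qed.

Lemma quad_cutoff1 r z : 0 < r -> r ^+ 2 <= sqnorm z -> quad_cutoff r z = 1.
Proof.
by move=> r0 zr; rewrite /quad_cutoff min_l// ler_pdivlMr ?exprn_gt0// mul1r.
Qed.

Lemma sqnorm_second_difference x z :
  sqnorm (x + z) + sqnorm (x - z) = 2 * sqnorm x + 2 * sqnorm z.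
Proof.
rewrite /sqnorm !mulr_sumr -!big_split/=; apply: eq_bigr => i _.
by rewrite !mxE; ring.
Qed.

(** Away from the region where it is constant, the cutoff is a quadratic
    polynomial, whose second differences do not depend on the base point. *)
Lemma quad_cutoff_second_difference r x z : 0 < r ->
  quad_cutoff r (x + z) + quad_cutoff r (x - z) - 2 * quad_cutoff r x <=
  2 * quad_cutoff r z.
Proof.
move=> r0.
have q0 := @quad_cutoff_ge0 R N r; have q1 := quad_cutoff_le1 r.
have [rx|/ltW xr] := leP (r ^+ 2) (sqnorm x).
  by rewrite (quad_cutoff1 r0 rx); have := q0 z; have := q1 (x + z);
    have := q1 (x - z); lra.
have [rz|/ltW zr] := leP (r ^+ 2) (sqnorm z).
  by rewrite (quad_cutoff1 r0 rz); have := q0 x; have := q1 (x + z);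
    have := q1 (x - z); lra.
rewrite (quad_cutoffE r0 xr) (quad_cutoffE r0 zr).
have qle (y : 'rV[R]_N) : quad_cutoff r y <= sqnorm y / r ^+ 2 by rewrite ge_min lexx orbT.
have := qle (x + z); have := qle (x - z).
have : sqnorm (x + z) / r ^+ 2 + sqnorm (x - z) / r ^+ 2 =
    2 * (sqnorm x / r ^+ 2) + 2 * (sqnorm z / r ^+ 2).
  by rewrite -mulrDl sqnorm_second_difference mulrDl !mulrA.
lra.
Qed.

(** The first-order part of the increment is not absolutely integrable
    uniformly in [eps] when $\sigma\ge 1/2$; the kernel being even, averaging
    with the reflected increment cancels it. *)
Lemma kernel_avg_quad_cutoff_increment eps r x : 0 < eps -> 0 < r ->
  kernel_avg sigma eps (fun z => quad_cutoff r (x + z) - quad_cutoff r x) <=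
  kernel_avg sigma eps (quad_cutoff r : 'rV[R]_N -> R).
Proof.
move=> e0 r0.
pose w z := quad_cutoff r (x + z) - quad_cutoff r x.
have bq := @bounded_measurable_quad_cutoff R N r.
have bw : bounded_measurable w.
  apply: bounded_measurableB; first exact: bounded_measurable_translation.
  exact: bounded_measurable_cst.
have bwN := bounded_measurable_reflection bw.
have : kernel_avg sigma eps (fun z => w z + w (- z)) <=
    kernel_avg sigma eps (fun z => 2 * quad_cutoff r z).
  apply: kernel_avg_le => //; first exact: bounded_measurableD.
    by apply: bounded_measurableM => //; exact: bounded_measurable_cst.
  by move=> z; rewrite /w; have := quad_cutoff_second_difference x z r0; lra.
rewrite kernel_avgD// kernel_avg_reflection// kernel_avgZ//; lra.
Qed.

End quad_cutoff_increment.

Section boundary_decay.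
Context {R : realType} {N : nat} (sigma : R).
Hypothesis sigma01 : 0 < sigma < 1.
Hypothesis N_gt0 : (0 < N)%N.
Local Notation p := (N%:R + 2 * sigma).
Implicit Types x z : 'rV[R]_N.

(** The equation in the form used from now on: the integral is a real number and
    continuity of [u] only enters through measurability. *)
Definition solves (eps : R) (Omega : set 'rV[R]_N) (f u : 'rV[R]_N -> R) :=
  [/\ bounded_measurable u, forall x, Omega x -> nonlocal sigma eps u x = f x &
      forall x, ~ Omega x -> u x = 0].

Lemma solvesN eps Omega f u : 0 < eps -> solves eps Omega f u ->
  solves eps Omega (fun x => - f x) (fun x => - u x).
Proof.
move=> e0 [bu uf u0]; split; first exact: bounded_measurableN.
  by move=> x Ox; rewrite nonlocalN// uf.
by move=> x Ox; rewrite u0// oppr0.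
Qed.

Lemma is_solution_solves eps Omega f u : 0 < eps -> open Omega ->
  is_solution sigma eps Omega f u -> solves eps Omega f u.
Proof.
move=> e0 oO [ub uc uf u0].
have bu : bounded_measurable u.
  split; first exact: measurable_continuous_zero_ext oO uc u0.
  have [M [_ HM]] := ub.
  by exists (M + 1) => z; apply: HM => //; rewrite ltrDl.
split => // x Ox; have := uf _ Ox.
have -> : I_eps sigma eps u x = (- nonlocal sigma eps u x)%:E.
  rewrite /nonlocal -kernel_avgN//; last exact: bounded_measurable_increment.
  rewrite /kernel_avg /Rintegral fineK; last first.
    apply: integrable_fin_num => //; apply: bounded_measurable_integrable => //.
    by apply: bounded_measurableN; exact: bounded_measurable_increment.
  by rewrite /I_eps; apply: eq_integral => z _; rewrite opprB.
by rewrite -EFinN opprK => -[].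
Qed.

Lemma exists_small_radius (b G : R) : 0 < b ->
  exists r, [/\ 0 < r, r <= b & G <= r `^ (- (2 * sigma))].
Proof.
move=> b0; have /andP[s0 _] := sigma01.
have s20 : 0 < 2 * sigma by rewrite mulr_gt0.
have G0 : 0 < `|G| + 1 by rewrite ltr_wpDl.
pose r := Num.min b ((`|G| + 1) `^ (- (2 * sigma)^-1)).
have r0 : 0 < r by rewrite lt_min b0 powR_gt0.
exists r; split; rewrite ?ge_min ?lexx//.
rewrite (@le_trans _ _ (`|G| + 1))//; first by have := ler_norm G; lra.
rewrite powRN -[leLHS]invrK lef_pV2 ?posrE ?invr_gt0 ?powR_gt0//.
apply: (@le_trans _ _ (((`|G| + 1) `^ (- (2 * sigma)^-1)) `^ (2 * sigma))).
  rewrite ge0_ler_powR ?(ltW s20)// ?nnegrE ?(ltW r0) ?powR_ge0//.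
  by rewrite ge_min lexx orbT.
by rewrite -powRrM mulNr mulVf ?gt_eqF// powR_inv1// ltW.
Qed.

Variables (Omega : set 'rV[R]_N) (rho : R).
Hypothesis open_Omega : open Omega.
Hypothesis Omega_rho : forall x, Omega x -> `|x| <= rho.

Variables (x0 : 'rV[R]_N) (c r0 : R).
Hypothesis c_gt0 : 0 < c.
Hypothesis r0_gt0 : 0 < r0.
Hypothesis exterior : forall r, 0 < r < r0 ->
  exists Q : set 'rV[R]_N, [/\ measurable Q, Q `<=` ~` Omega,
    forall x, Q x -> `|x - x0| <= r & ((c * r ^+ N)%:E <= lebesgue_rV Q)%E].

(** As long as [eps <= r], the kernel is bounded below by a multiple of
    $r^{-N-2\sigma}$ on the ball of radius comparable to [r], and the exterior
    set seen from [x] has measure at least [c * r ^+ N]. *)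
Lemma exterior_mass_ge eps r x (Q : set 'rV[R]_N) :
  0 < eps -> eps <= r -> `|x - x0| <= r -> measurable Q ->
  (forall x, Q x -> `|x - x0| <= r) -> ((c * r ^+ N)%:E <= lebesgue_rV Q)%E ->
  c / (2 * (2 * N%:R) `^ p) * r `^ (- (2 * sigma)) <=
  kernel_avg sigma eps (fun z => \1_Q (x + z)).
Proof.
move=> e0 er xr mQ Qr Qm; have r_gt0 := lt_le_trans e0 er.
have N1 : 1 <= N%:R :> R by rewrite ler1n.
have mQx : measurable ((fun z => x + z) @^-1` Q).
  by rewrite -[X in measurable X]setTI; exact: measurable_fun_translation.
pose X := 2 * N%:R * r.
have X0 : 0 < X by rewrite !mulr_gt0// ltr0n.
have rX : r <= X by rewrite /X -[leLHS]mul1r ler_wpM2r ?(ltW r_gt0)//; lra.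
have := @kernel_avg_indic_ge R N sigma sigma01 eps ((fun z => x + z) @^-1` Q)
  (2 * X `^ p)^-1 (c * r ^+ N) e0 mQx.
rewrite (_ : c / _ * _ = (2 * X `^ p)^-1 * (c * r ^+ N)); last first.
  have N20 : 0 <= 2 * N%:R :> R by lra.
  rewrite /X (powRM _ N20 (ltW r_gt0)).
  rewrite -[r ^+ N]powR_mulrn ?(ltW r_gt0)//.
  have -> : r `^ (- (2 * sigma)) = r `^ N%:R / r `^ p.
    by rewrite -powRB ?(gt_eqF r_gt0) ?implybT//; congr (_ `^ _); lra.
  by rewrite !invfM; ring.
apply; rewrite ?invr_ge0 ?mulr_ge0 ?powR_ge0//.
- move=> z Qz; apply: kernel_ge => //; first exact: le_trans er rX.
  rewrite (le_trans (enorm_le z))// /X -mulrA mulrCA ler_wpM2l//.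
  have := ler_normB (x + z - x0) (x - x0).
  have -> : x + z - x0 - (x - x0) = z by rewrite opprB addrA subrK addrAC subrr add0r.
  by have := Qr _ Qz; lra.
- by rewrite (lebesgue_rV_translation x mQ).
Qed.

(** One step of the oscillation decay.  The barrier is [T] times
    $1 - \theta + \theta\min(1, |x - x_0|^2/r^2)$ on [Omega], raised by the
    global bound [M] far from [x0].  The jump to [0] on the exterior set of mass
    proportional to $r^N$ contributes $r^{-2\sigma}$ to [nonlocal], the
    quadratic variation costs at most $\theta r^{-2\sigma}$, and the far term
    is bounded independently of [r]. *)
Lemma boundary_decay_step : exists2 theta : R, 0 < theta < 1 &
  forall F M eta r1 : R, 0 <= F -> 0 <= M -> 0 < eta -> 0 < r1 ->
  exists2 r2 : R, 0 < r2 & forall T, eta <= T -> forall eps f u,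
    0 < eps < 1 -> eps < r2 -> solves eps Omega f u ->
    (forall x, Omega x -> f x <= F) -> (forall x, u x <= M) ->
    (forall x, `|x - x0| < r1 -> u x <= T) ->
    forall x, `|x - x0| < r2 -> u x <= (1 - theta) * T.
Proof.
have [C C0 Cle] := kernel_avg_quad_cutoff_le (N := N) sigma01.
have N1 : 1 <= N%:R :> R by rewrite ler1n.
pose c' := c / (2 * (2 * N%:R) `^ p).
have c'0 : 0 < c' by rewrite divr_gt0// mulr_gt0// powR_gt0//; lra.
(* Half of the gain from the exterior mass is left after paying for the quadratic
   variation: [(1 - th) * c' - th * C = c' / 2]. *)
pose th := c' / (2 * (c' + C)).
have cC0 : 0 < 2 * (c' + C) by lra.
have th0 : 0 < th by rewrite divr_gt0.
have th1 : th < 1 by rewrite ltr_pdivrMr//; lra.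
have thE : th * (c' + C) = c' / 2.
  by rewrite /th invfM mulrA mulfVK// gt_eqF//; lra.
exists (th / 2); first by lra.
move=> F M eta r1 F0 M0 eta0 r10.
pose far := M * (C * (r1 / 4) `^ (- (2 * sigma))).
have far0 : 0 <= far by rewrite !mulr_ge0 ?powR_ge0// ltW.
have b0 : 0 < Num.min (r1 / 4) (r0 / 2) by rewrite lt_min !divr_gt0.
(* The scale at which the gain [eta * c' / 2 * r^(- 2 sigma)] outweighs the
   right-hand side and the values of [u] far from [x0]. *)
have [r [r_gt0 rb Gr]] := exists_small_radius ((F + far) / (eta * c' / 2)) b0.
move: rb; rewrite le_min => /andP[rr1 rr0].
have rrange : 0 < r < r0 by lra.
have [Q [mQ QO Qr Qm]] := exterior rrange.
exists (r / (2 * N%:R)); first by rewrite divr_gt0//; lra.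
have r2r : r / (2 * N%:R) <= r.
  by rewrite ler_pdivrMr ?ler_peMr//; lra.
move=> T etaT eps f u /andP[e0 e1] er2 [bu uf u0] fF uM uT.
have T0 : 0 < T by lra.
have er : eps <= r by lra.
pose rs := r `^ (- (2 * sigma)).
have rs0 : 0 < rs by rewrite powR_gt0.
have Trs : F + far <= T * (c' / 2) * rs.
  have Grs : F + far <= eta * c' / 2 * rs.
    by move: Gr; rewrite -/rs ler_pdivrMr 1?[rs * _]mulrC// divr_gt0// mulr_gt0.
  rewrite (le_trans Grs)// ler_wpM2r ?(ltW rs0)// -mulrA ler_wpM2r//; lra.
pose far1 : 'rV[R]_N -> R := fun x => \1_(~` cube (r1 / 2)) (- x0 + x).
pose profile x := T * (1 - th) + T * th * quad_cutoff r (- x0 + x).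
pose b x := \1_Omega x * profile x + M * far1 x.
have bcst a := @bounded_measurable_cst R N a.
have mO := open_rV_measurable open_Omega.
have mfar : measurable (~` cube (r1 / 2) : set 'rV[R]_N).
  by apply: measurableC; exact: measurable_cube.
have bfar1 : bounded_measurable far1.
  apply: (bounded_measurable_translation (w := \1_(~` cube (r1 / 2)))).
  exact: bounded_measurable_indic.
have bqx0 : bounded_measurable (fun x => quad_cutoff r (- x0 + x)).
  apply: (bounded_measurable_translation (w := quad_cutoff r)).
  exact: bounded_measurable_quad_cutoff.
have bprofile : bounded_measurable profile.
  apply: bounded_measurableD => //; apply: bounded_measurableM => //.
have bb : bounded_measurable b.
  apply: bounded_measurableD; apply: bounded_measurableM => //.
  exact: bounded_measurable_indic.
have far10 x : 0 <= far1 x by rewrite /far1 indicE.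
have profile0 x : 0 <= profile x.
  rewrite addr_ge0// mulr_ge0//; try lra.
    by rewrite mulr_ge0// ltW.
  exact: quad_cutoff_ge0.
(* The region where the profile is a quadratic polynomial; outside of it the
   barrier already dominates [u]. *)
pose D := Omega `&` [set x | sqnorm (x - x0) < r ^+ 2].
have DE x : D x -> `|x - x0| < r.
  move=> [_ /= xr]; rewrite -(@ltr_pXn2r _ 2)// ?nnegrE ?(ltW r_gt0)//.
  exact: le_lt_trans (norm_sq_le _) xr.
have notfar x : `|x - x0| <= r1 / 2 -> far1 x = 0.
  by move=> xr; rewrite /far1 indicE memNset//= addrC => /(_ xr).
have isfar x : ~ `|x - x0| <= r1 / 2 -> far1 x = 1.
  by move=> xr; rewrite /far1 indicE mem_set//= addrC.
have Drho x : D x -> `|x| <= rho by move=> [/Omega_rho].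
have [kappa kappa0 kappaE] : exists2 kappa : R, 0 < kappa &
    kappa <= kernel_avg sigma eps \1_(~` cube (2 * (`|rho| + 1)) : set 'rV[R]_N).
  have [|kappa k0 H] := @kernel_tail_mass_ge R N sigma sigma01 N_gt0 (`|rho| + 1).
    by rewrite ltr_wpDl.
  by exists kappa => //; apply: H; rewrite e0.
suff key x : u x - b x <= 0.
  move=> x xr2; have [Ox|/u0 ->] := pselect (Omega x); last first.
    by rewrite mulr_ge0 ?(ltW T0)//; lra.
  have xr : `|x - x0| < r by lra.
  have := key x; rewrite /b notfar; last by lra.
  rewrite indicE mem_set// mul1r mulr0 addr0 /profile subr_le0 => /le_trans; apply.
  have : quad_cutoff r (- x0 + x) <= 1 / 2.
    rewrite (@le_trans _ _ (sqnorm (- x0 + x) / r ^+ 2)) ?ge_min ?lexx ?orbT//.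
    rewrite ler_pdivrMr ?exprn_gt0// addrC (le_trans (sqnorm_le _))//.
    have : (2 * N%:R * `|x - x0|) ^+ 2 <= r ^+ 2.
      rewrite ler_sqr ?nnegrE ?mulr_ge0 ?(ltW r_gt0)// mulrC.
      by rewrite -ler_pdivlMr ?(ltW xr2)//; lra.
    have : N%:R * `|x - x0| ^+ 2 <= (N%:R * `|x - x0|) ^+ 2.
      by rewrite exprMn ler_wpM2r ?sqr_ge0// expr2 ler_peMr.
    rewrite -mulrA exprMn; have := sqr_ge0 (N%:R * `|x - x0|); lra.
  have : 0 < T * th by rewrite mulr_gt0.
  move: (quad_cutoff _ _) => q Tth0 q12.
  have : T * th * q <= T * th * (1 / 2) by rewrite ler_wpM2l// ltW.
  lra.
rewrite -[leRHS](_ : 0 + 0 / kappa = 0); last by rewrite mul0r addr0.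
apply: (@max_principle R N sigma sigma01 eps (fun y => u y - b y) D (`|rho| + 1)
  0 0 kappa e0 _ _ _ _ _ kappa0 kappaE) => //.
- exact: bounded_measurableB.
- by move=> y /Drho yr; have := ler_norm rho; lra.
- move=> y Dy; rewrite subr_le0.
  have [Oy|/[dup] Oy /u0 ->] := pselect (Omega y); last first.
    by rewrite /b addr_ge0// mulr_ge0.
  have yr : r ^+ 2 <= sqnorm (- x0 + y).
    by rewrite addrC leNgt; apply/negP => ?; apply: Dy; split.
  rewrite /b indicE mem_set// mul1r /profile quad_cutoff1//.
  have [yr1|yr1] := pselect (`|y - x0| <= r1 / 2).
    by rewrite notfar// mulr0 addr0; have := uT y; have : `|y - x0| < r1; lra.
  by rewrite isfar//; have := uM y; lra.
- move=> {}x Dx; rewrite nonlocalB// uf; last by case: Dx.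
  have [Ox /= xq] := Dx; have xr := DE _ Dx.
  have fx := fF _ Ox.
  suff : F <= nonlocal sigma eps b x by lra.
  pose a := - x0 + x.
  pose w1 z := quad_cutoff r (a + z) - quad_cutoff r a.
  pose w2 z : R := \1_Q (x + z).
  have bw1 : bounded_measurable w1.
    apply: bounded_measurableB => //; apply: bounded_measurable_translation.
    exact: bounded_measurable_quad_cutoff.
  have bw2 : bounded_measurable w2.
    apply: (bounded_measurable_translation (w := \1_Q)).
    exact: bounded_measurable_indic.
  have bw3 := @bounded_measurable_quad_cutoff R N (r1 / 4).
  have bw12 : bounded_measurable (fun z => T * (1 - th) * w2 z - T * th * w1 z).
    by apply: bounded_measurableB; apply: bounded_measurableM.
  have bMw3 : bounded_measurable (fun z => M * quad_cutoff (r1 / 4) z).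
    by apply: bounded_measurableM.
  have H1 : kernel_avg sigma eps w1 <= C * rs.
    apply: le_trans (Cle eps r e0 r_gt0).
    exact: kernel_avg_quad_cutoff_increment.
  have H2 : c' * rs <= kernel_avg sigma eps w2.
    by apply: exterior_mass_ge => //; exact: ltW.
  have H3 : M * kernel_avg sigma eps (quad_cutoff (r1 / 4) : 'rV[R]_N -> R) <= far.
    by rewrite /far ler_wpM2l//; apply: Cle => //; rewrite divr_gt0.
  apply: (@le_trans _ _ (kernel_avg sigma eps (fun z =>
      (T * (1 - th) * w2 z - T * th * w1 z) - M * quad_cutoff (r1 / 4) z))).
    rewrite kernel_avgB// kernel_avgB//; try exact: bounded_measurableM.
    rewrite !kernel_avgZ//.
    have H1' : T * th * kernel_avg sigma eps w1 <= T * th * (C * rs).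
      by rewrite ler_wpM2l// mulr_ge0// ltW.
    have H2' : T * (1 - th) * (c' * rs) <= T * (1 - th) * kernel_avg sigma eps w2.
      by rewrite ler_wpM2l// mulr_ge0//; lra.
    have -> : F = F + far - far by lra.
    have E : T * (1 - th) * (c' * rs) - T * th * (C * rs) = T * (c' / 2) * rs.
      have -> : c' / 2 = c' - th * (c' + C) by rewrite thE; lra.
      by ring.
    lra.
  apply: kernel_avg_le => //; first exact: bounded_measurableB.
    exact: bounded_measurable_increment.
  move=> z; rewrite /b notfar; last by lra.
  rewrite [\1_Omega x]indicE mem_set// mul1r mulr0 addr0.
  have far1_le : far1 (x + z) <= quad_cutoff (r1 / 4) z.
    have [xz|xz] := pselect (`|x + z - x0| <= r1 / 2).
      by rewrite notfar// quad_cutoff_ge0.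
    rewrite isfar// quad_cutoff1//; first by rewrite divr_gt0.
    rewrite (le_trans _ (norm_sq_le z))// ler_sqr ?nnegrE ?divr_ge0 ?(ltW r10)//.
    have := ler_normD (x - x0) z.
    by rewrite addrAC; move/negP: xz; rewrite -ltNge; lra.
  have profile_diff : profile (x + z) - profile x = T * th * w1 z.
    by rewrite /profile /w1 /a addrA; ring.
  have Mfar : M * far1 (x + z) <= M * quad_cutoff (r1 / 4) z by rewrite ler_wpM2l.
  suff : \1_Omega (x + z) * profile (x + z) <= profile (x + z) - T * (1 - th) * w2 z.
    by lra.
  rewrite /w2 !indicE; case: (boolP (x + z \in Q)) => [xzQ|_].
    rewrite memNset ?mul0r ?mulr1; last by apply: QO; exact: set_mem.
    rewrite /profile [leRHS]addrAC subrr add0r mulr_ge0 ?quad_cutoff_ge0//.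
    by rewrite mulr_ge0// ltW.
  by rewrite mulr0 subr0 ler_piMl//; case: (_ \in _).
Qed.

(** The improvement factor of [boundary_decay_step] is the same at every step, so
    finitely many steps reach [eta]; each of them shrinks the ball and the range
    of [eps]. *)
Lemma boundary_decay (F M eta : R) : 0 <= F -> 0 <= M -> 0 < eta ->
  exists2 r : R, 0 < r & forall eps f u, 0 < eps < 1 -> eps < r ->
    solves eps Omega f u -> (forall x, Omega x -> f x <= F) ->
    (forall x, u x <= M) -> forall x, `|x - x0| < r -> u x <= eta.
Proof.
move=> F0 M0 eta0; have [th /andP[th0 th1] step] := boundary_decay_step.
(* The summand [eta / 2] keeps the bounds in the range where a step applies. *)
pose T k := M * (1 - th) ^+ k + eta / 2.
have T_ge k : eta / 2 <= T k.
  by rewrite lerDr mulr_ge0// exprn_ge0//; lra.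
have TS k : (1 - th) * T k <= T k.+1.
  rewrite /T exprS mulrDr mulrCA lerD2l -[leRHS]mul1r ler_wpM2r//; lra.
have iter k : exists2 r : R, 0 < r & forall eps f u, 0 < eps < 1 -> eps < r ->
    solves eps Omega f u -> (forall x, Omega x -> f x <= F) ->
    (forall x, u x <= M) -> forall x, `|x - x0| < r -> u x <= T k.
  elim: k => [|k [r1 r10 IH]].
    exists 1 => // eps f u _ _ _ _ uM x _.
    by rewrite /T expr0 mulr1; have := uM x; lra.
  have [|r2 r20 H] := step F M (eta / 2) r1 F0 M0 _ r10; first by lra.
  exists (Num.min r1 r2); first by rewrite lt_min r10 r20.
  move=> eps f u e01; rewrite lt_min => /andP[er1 er2] su fF uM x.
  rewrite lt_min => /andP[_ xr2]; rewrite (le_trans _ (TS k))//.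
  by apply: (H (T k) (T_ge k) eps f u) => // y yr1; exact: (IH eps f u).
have [k Tk] : exists k, T k <= eta.
  have th11 : `|1 - th| < 1 by rewrite ltr_norml; lra.
  have cvg0 := cvg_geometric M th11.
  have /cvgr0_norm_le := cvg0 => /(_ (eta / 2)); case; first by lra.
  move=> k _ /(_ k (leqnn k)) Hk; exists k; rewrite /T.
  by have := ler_norm (M * (1 - th) ^+ k); move: Hk; rewrite /geometric/=; lra.
have [r rp H] := iter k; exists r => // eps f u e01 er su fF uM x xr.
exact: le_trans (H _ _ _ e01 er su fF uM _ xr) Tk.
Qed.

End boundary_decay.

(** * Equicontinuity *)

Section equicontinuity.
Context {R : realType} {N : nat} (sigma : R).
Hypothesis sigma01 : 0 < sigma < 1.
Hypothesis N_gt0 : (0 < N)%N.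
Local Notation p := (N%:R + 2 * sigma).
Local Notation K := (@kernel_eps R N sigma).
Implicit Types x y z h : 'rV[R]_N.

Let p_gt0 : 0 < p.
Proof. by have /andP[s0 _] := sigma01; rewrite ltr_wpDl// mulr_gt0. Qed.

Lemma sqnormD_le x y (a : R) : 0 < a ->
  sqnorm (x + y) <= (1 + a) * sqnorm x + (1 + a^-1) * sqnorm y.
Proof.
move=> a0; rewrite /sqnorm !mulr_sumr -big_split/=; apply: ler_sum => i _.
rewrite !mxE -subr_ge0.
have -> : (1 + a) * x 0 i ^+ 2 + (1 + a^-1) * y 0 i ^+ 2 - (x 0 i + y 0 i) ^+ 2 =
    a^-1 * (a * x 0 i - y 0 i) ^+ 2 by field; rewrite gt_eqF.
by rewrite mulr_ge0 ?sqr_ge0 ?invr_ge0 ?ltW.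
Qed.

(** For [eps] bounded below, [K] is logarithmically uniformly continuous: where
    $|z|$ is large compared with $|h|$ the two powers are comparable, elsewhere
    both are negligible in front of $\epsilon^{N+2\sigma}$. *)
Lemma kernel_shift_le (e0 tau : R) : 0 < e0 -> 0 < tau ->
  exists2 delta : R, 0 < delta & forall eps z h, e0 <= eps -> `|h| < delta ->
    K eps z <= (1 + tau) * K eps (z + h).
Proof.
move=> e00 tau0.
(* Stretching by [l] multiplies the power [p] of the norm by [1 + tau]; [a] is the
   weight in [sqnormD_le] for which [1 + 2 * a = l ^+ 2]. *)
pose l := (1 + tau) `^ p^-1.
have l1 : 1 < l.
  rewrite /l -[X in X < _](congr1 (fun f => f p^-1) (powR1 R)).
  by apply: gt0_ltr_powR; rewrite ?invr_gt0 ?nnegrE//; lra.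
have lp : l `^ p = 1 + tau.
  by rewrite /l -powRrM mulVf ?gt_eqF// powRr1//; lra.
pose a := (l ^+ 2 - 1) / 2.
have a0 : 0 < a.
  by rewrite divr_gt0// subr_gt0 exprn_egt1.
pose B := (1 + a^-1) / a.
have ai0 : 0 < a^-1 by rewrite invr_gt0.
have B0 : 0 < B by rewrite divr_gt0//; lra.
pose C := (1 + a) * B + (1 + a^-1).
have C0 : 0 < C by rewrite addr_gt0 ?mulr_gt0//; lra.
pose s := tau `^ p^-1 * e0.
have s0 : 0 < s by rewrite mulr_gt0// powR_gt0.
have sp : s `^ p = tau * e0 `^ p.
  rewrite /s powRM ?powR_ge0 ?(ltW e00)// -powRrM mulVf ?gt_eqF// powRr1//.
  exact: ltW.
have CN0 : 0 < C * N%:R by rewrite mulr_gt0// ltr0n.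
have CN1 : 0 < C * N%:R + 1 by lra.
exists (s / (C * N%:R + 1)); first by rewrite divr_gt0.
move=> eps z h e0eps hs.
have eps0 : 0 < eps by lra.
have denom0 x : 0 < eps `^ p + enorm x `^ p.
  by rewrite ltr_pwDl ?powR_ge0 ?powR_gt0.
suff : eps `^ p + enorm (z + h) `^ p <= (1 + tau) * (eps `^ p + enorm z `^ p).
  move=> H; rewrite /kernel_eps !div1r -ler_pdivrMl ?addr_gt0//.
  by rewrite -invfM lef_pV2 ?posrE// mulr_gt0//; lra.
have epsp0 : 0 <= eps `^ p by exact: powR_ge0.
have zp0 : 0 <= enorm z `^ p by exact: powR_ge0.
have pow_mono (b c : R) : 0 <= b -> b <= c -> b `^ p <= c `^ p.
  move=> b0 bc; rewrite ge0_ler_powR ?(ltW p_gt0)// nnegrE//.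
  exact: le_trans bc.
have q0 x : 0 <= sqnorm x by exact: sqnorm_ge0.
have Hq := sqnormD_le z h a0.
have [small|large] := leP ((1 + a^-1) * sqnorm h) (a * sqnorm z).
  have : enorm (z + h) <= l * enorm z.
    rewrite -(@ler_pXn2r _ 2)// ?nnegrE ?enorm_ge0 ?mulr_ge0 ?enorm_ge0//; try lra.
    rewrite exprMn !enorm_sq.
    have -> : l ^+ 2 = 1 + a + a by rewrite /a; lra.
    lra.
  move=> /(pow_mono _ _ (enorm_ge0 _)); rewrite powRM ?enorm_ge0//; last by lra.
  rewrite lp => H; rewrite mulrDr; apply: lerD => //.
  by rewrite ler_peMl//; lra.
have zB : sqnorm z <= B * sqnorm h.
  by rewrite /B mulrAC ler_pdivlMr// mulrC ltW.
have zhC : sqnorm (z + h) <= C * sqnorm h.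
  have : (1 + a) * sqnorm z <= (1 + a) * (B * sqnorm h) by rewrite ler_wpM2l//; lra.
  by rewrite /C; lra.
have : enorm (z + h) <= s.
  rewrite -(@ler_pXn2r _ 2)// ?nnegrE ?enorm_ge0 ?(ltW s0)// enorm_sq.
  rewrite (le_trans zhC)//.
  apply: (@le_trans _ _ (C * (N%:R * `|h| ^+ 2))).
    by rewrite ler_wpM2l ?sqnorm_le// ltW.
  rewrite mulrA; apply: (@le_trans _ _ ((`|h| * (C * N%:R + 1)) ^+ 2)).
    rewrite exprMn mulrC ler_wpM2l ?sqr_ge0//.
    have := sqr_ge0 (C * N%:R); lra.
  have hCs : `|h| * (C * N%:R + 1) <= s by rewrite -ler_pdivlMr// ltW.
  by rewrite ler_sqr ?nnegrE ?(ltW s0)// mulr_ge0// ltW.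
move=> /(pow_mono _ _ (enorm_ge0 _)); rewrite sp => H.
have : tau * e0 `^ p <= tau * eps `^ p.
  by rewrite ler_wpM2l ?(ltW tau0)// pow_mono// ltW.
have : 0 <= tau * enorm z `^ p by rewrite mulr_ge0// ltW.
lra.
Qed.

Variables (Omega : set 'rV[R]_N) (rho : R) (f : 'rV[R]_N -> R) (F : R).
Hypothesis Omega_rho : forall x, Omega x -> `|x| <= rho.
Hypothesis fF : forall x, Omega x -> `|f x| <= F.
Hypothesis F_ge0 : 0 <= F.
Hypothesis f_unif : forall eta : R, 0 < eta -> exists2 delta : R, 0 < delta &
  forall x y, Omega x -> Omega y -> `|x - y| < delta -> `|f x - f y| <= eta.

Lemma tail_mass : exists2 kappa : R, 0 < kappa & forall eps, 0 < eps < 1 ->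
  kappa <= kernel_avg sigma eps
    \1_(~` cube (2 * (`|rho| + 1)) : set 'rV[R]_N).
Proof. by apply: kernel_tail_mass_ge => //; rewrite ltr_wpDl. Qed.

Let Omega_rho1 x : Omega x -> `|x| <= `|rho| + 1.
Proof. by move=> /Omega_rho; have := ler_norm rho; lra. Qed.

Lemma solution_uniform_bound : exists2 M : R, 0 <= M & forall eps u,
  0 < eps < 1 -> solves sigma eps Omega f u -> forall x, `|u x| <= M.
Proof.
have [kappa kappa0 kappaE] := tail_mass.
exists (F / kappa); first by rewrite divr_ge0// ltW.
have upper eps g u : 0 < eps < 1 -> (forall x, Omega x -> `|g x| <= F) ->
    solves sigma eps Omega g u -> forall x, u x <= F / kappa.
  move=> /[dup] e01 /andP[e0 _] gF [bu ug u0] x.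
  rewrite -[leRHS]add0r.
  apply: (@max_principle R N sigma sigma01 eps u Omega (`|rho| + 1) F 0 kappa
    e0 bu Omega_rho1 _ _ F_ge0 kappa0 (kappaE _ e01)).
  - by move=> y /u0 ->.
  - by move=> y Oy; rewrite ug// (le_trans (ler_norm _))// gF.
move=> eps u e01 su x; rewrite ler_norml; apply/andP; split.
  rewrite lerNl; apply: (upper eps (fun x => - f x) (fun x => - u x)) => //.
    by move=> y Oy; rewrite normrN fF.
  by apply: solvesN => //; case/andP: e01.
exact: (upper eps f u).
Qed.

(** Small [eps]: [u] is uniformly small in a boundary layer, so the difference
    of [u] and a translate is controlled outside the intersection of the two
    domains, and the maximum principle extends this control inside. *)
Lemma equicontinuity_small_eps (eta delta0 : R) : 0 < eta -> 0 < delta0 ->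
  (forall eps u, 0 < eps < 1 -> eps < delta0 -> solves sigma eps Omega f u ->
    forall x y, Omega x -> ~ Omega y -> `|x - y| < delta0 -> `|u x| <= eta / 2) ->
  exists2 delta : R, 0 < delta & forall eps u, 0 < eps < 1 -> eps < delta0 ->
    solves sigma eps Omega f u ->
    forall x y, Omega x -> Omega y -> `|x - y| < delta -> u x - u y <= eta.
Proof.
move=> eta0 delta00 layer.
have [kappa kappa0 kappaE] := tail_mass.
have tau0 : 0 < eta / 2 * kappa by rewrite mulr_gt0// divr_gt0.
have [delta1 delta10 fd] := f_unif tau0.
exists (Num.min delta0 delta1); first by rewrite lt_min delta00 delta10.
move=> eps u /[dup] e01 /andP[e0 _] ed su x y Ox Oy.
rewrite lt_min => /andP[xy0 xy1].
have [bu uf u0] := su.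
pose h := x - y.
pose v z := u (h + z) - u z.
pose D := [set z | Omega z /\ Omega (h + z)].
have hz z : h + z - z = h by rewrite addrK.
have bv : bounded_measurable v.
  by apply: bounded_measurableB => //; exact: bounded_measurable_translation.
have vD z : D z -> nonlocal sigma eps v z <= eta / 2 * kappa.
  move=> [Oz Ohz].
  rewrite nonlocalB//; last exact: bounded_measurable_translation.
  rewrite nonlocal_translation !uf//.
  by rewrite (le_trans (ler_norm _))// fd// hz.
have vDc z : ~ D z -> v z <= eta / 2.
  move=> nD; rewrite /v.
  have [Oz|nOz] := pselect (Omega z); have [Ohz|nOhz] := pselect (Omega (h + z)).
  - by exfalso; apply: nD.
  - rewrite (u0 _ nOhz) sub0r (le_trans (ler_norm _))// normrN.
    by apply: (layer eps u e01 ed su z (h + z)) => //; rewrite distrC hz.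
  - rewrite (u0 _ nOz) subr0 (le_trans (ler_norm _))//.
    by apply: (layer eps u e01 ed su (h + z) z) => //; rewrite hz.
  - by rewrite (u0 _ nOz) (u0 _ nOhz) subr0 divr_ge0// ltW.
have Drho z : D z -> `|z| <= `|rho| + 1 by move=> [/Omega_rho1].
have := @max_principle R N sigma sigma01 eps v D (`|rho| + 1)
  (eta / 2 * kappa) (eta / 2) kappa e0 bv Drho vDc vD (ltW tau0) kappa0
  (kappaE _ e01) y.
by rewrite mulfK ?gt_eqF// /v /h subrK; lra.
Qed.

(** For [eps] bounded below the equation is solved for [u x] itself: [u] is the
    sum of [f] and of a convolution with [K], divided by the mass of [K]. *)
Lemma equicontinuity_large_eps (e0 eta : R) : 0 < e0 -> 0 < eta ->
  exists2 delta : R, 0 < delta & forall eps u, e0 <= eps -> 0 < eps < 1 ->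
    solves sigma eps Omega f u ->
    forall x y, Omega x -> Omega y -> `|x - y| < delta -> u x - u y <= eta.
Proof.
move=> e00 eta0.
have [kappa kappa0 kappaE] := tail_mass.
have [M M0 uM] := solution_uniform_bound.
have tau0 : 0 < eta / 2 * kappa by rewrite mulr_gt0// divr_gt0.
have [delta1 delta10 fd] := f_unif tau0.
pose tau := eta / 2 / (M + 1).
have tau_gt0 : 0 < tau by rewrite !divr_gt0//; lra.
have Mtau : M * tau <= eta / 2.
  rewrite /tau mulrCA ger_pMr ?divr_gt0//.
  by rewrite ler_pdivrMr//; lra.
have [delta2 delta20 Kd] := kernel_shift_le e00 tau_gt0.
exists (Num.min delta1 delta2); first by rewrite lt_min delta10 delta20.
move=> eps u e0eps /[dup] e01 /andP[eps0 _] su x y Ox Oy.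
rewrite lt_min => /andP[xy1 xy2].
have [bu uf u0] := su.
have b1 := @bounded_measurable_cst R N 1.
pose m := kernel_avg sigma eps (fun _ : 'rV[R]_N => 1).
have mkappa : kappa <= m.
  apply: le_trans (kappaE _ e01) _; apply: kernel_avg_le => //.
  by apply: bounded_measurable_indic; apply: measurableC; exact: measurable_cube.
have m0 : 0 < m by lra.
have avgE z : Omega z -> u z * m = f z + kernel_avg sigma eps (fun w => u (z + w)).
  move=> Oz; rewrite -(uf _ Oz) /nonlocal kernel_avgB//; last 2 first.
  - exact: bounded_measurable_cst.
  - exact: bounded_measurable_translation.
  rewrite subrK /m -kernel_avgZ//; apply: eq_Rintegral => w _.
  by rewrite mulr1.
pose h := y - x.
have hd2 : `|h| < delta2 by rewrite /h distrC.
(* Averages of [u] around [x] are rewritten as averages around [y] with the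
   density [psi], close to 1, with respect to the kernel. *)
pose psi z := K eps (h + z) / K eps z.
have K0 z : 0 < K eps z by exact: kernel_gt0.
have psi_le z : psi z <= 1 + tau.
  rewrite /psi ler_pdivrMr// addrC.
  have := Kd eps (z + h) (- h) e0eps; rewrite normrN => /(_ hd2).
  by rewrite addrK.
have psi_ge z : 1 - tau <= psi z.
  rewrite /psi ler_pdivlMr// [h + z]addrC.
  have := Kd eps z h e0eps hd2; have := K0 (z + h); have := K0 z.
  have := tau_gt0; move: (K eps z) (K eps (z + h)) (tau) => a b t t0 a0 b0 ab.
  have : 0 <= t ^+ 2 * b by rewrite mulr_ge0 ?sqr_ge0// ltW.
  have [t1|t1] := leP t 1; last first.
    have : (t - 1) * a >= 0 by rewrite mulr_ge0//; lra.
    lra.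
  have : (1 - t) * a <= (1 - t) * ((1 + t) * b) by rewrite ler_wpM2l//; lra.
  lra.
have bpsi : bounded_measurable psi.
  split; last first.
    exists (1 + tau) => z; rewrite ger0_norm ?psi_le//.
    by rewrite divr_ge0// ltW.
  have mK : measurable_fun setT (K eps) by exact: measurable_kernel_eps.
  rewrite (_ : psi = fun z => K eps (h + z) * (K eps z) `^ (-1)); last first.
    by apply/funext => z; rewrite powR_inv1// ltW.
  apply: measurable_funM.
    exact: (measurableT_comp mK (measurable_fun_translation h)).
  exact: (measurableT_comp (measurable_powR (-1)) mK).
have buy := bounded_measurable_translation y bu.
have bupsi : bounded_measurable (fun z => u (y + z) * psi z).
  exact: bounded_measurableM.
have avgx : kernel_avg sigma eps (fun z => u (x + z)) =
    kernel_avg sigma eps (fun z => u (y + z) * psi z).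
  have E z : u (x + (h + z)) * K eps (h + z) = u (y + z) * psi z * K eps z.
    rewrite /psi /h mulrA divfK ?gt_eqF//.
    by congr (u _ * _); rewrite addrA addrCA subrr addr0.
  have mw : measurable_fun setT (fun z => u (x + z) * K eps z).
    apply: measurable_funM; first exact: (bounded_measurable_translation x bu).1.
    exact: measurable_kernel_eps.
  have iw : (@lebesgue_rV R N).-integrable setT
      (EFin \o ((fun z => u (x + z) * K eps z) \o (fun z => h + z))).
    apply: eq_integrable (bounded_measurable_integrable sigma01 eps0 bupsi) => //.
    by move=> z _ /=; rewrite E.
  rewrite /kernel_avg -(Rintegral_measure_preserving
    (measurable_fun_translation h) (@lebesgue_rV_translation R N h) mw iw).
  by apply: eq_Rintegral => z _; rewrite E.
have : kernel_avg sigma eps (fun z => u (y + z) * psi z) -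
    kernel_avg sigma eps (fun z => u (y + z)) <= M * tau * m.
  rewrite -kernel_avgB// /m -kernel_avgZ//; apply: kernel_avg_le => //.
  - exact: bounded_measurableB.
  - by apply: bounded_measurableM => //; exact: bounded_measurable_cst.
  - move=> z; rewrite mulr1 -[X in _ - X]mulr1 -mulrBr (le_trans (ler_norm _))//.
    rewrite normrM ler_pM//; first exact: uM e01 su _.
    by rewrite ler_norml; have := psi_le z; have := psi_ge z; lra.
have := avgE _ Ox; have := avgE _ Oy; rewrite avgx.
have := fd _ _ Ox Oy xy1; rewrite ler_norml => /andP[_ fxy].
move=> Ey Ex avgxy.
rewrite -(ler_pM2r m0) mulrBl Ex Ey.
have : eta / 2 * kappa <= eta / 2 * m by rewrite ler_wpM2l// ltW// divr_gt0.
have : M * tau * m <= eta / 2 * m by rewrite ler_wpM2r// ltW.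
lra.
Qed.

End equicontinuity.

Section compactness.
Context {R : realType} {N : nat} (sigma : R).
Hypothesis sigma01 : 0 < sigma < 1.
Hypothesis N_gt0 : (0 < N)%N.
Implicit Types x y z : 'rV[R]_N.

Lemma compact_closure_bounded (Omega : set 'rV[R]_N) rho :
  (forall x, Omega x -> `|x| <= rho) -> compact (closure Omega).
Proof.
move=> Orho; apply: bounded_closed_compact; last exact: closed_closure.
exists (rho + 1); split; first exact: num_real.
move=> t rt x cx; have [y [Oy]] := cx _ (nbhsx_ballx x 1 ltr01).
rewrite -ball_normE /= => xy.
rewrite -(subrK y x) (le_trans (ler_normD _ _))//.
by have := Orho _ Oy; lra.
Qed.

Lemma compact_uniformly_continuous (A : set 'rV[R]_N) (f : 'rV[R]_N -> R) :
  compact A -> {within A, continuous f} -> forall eta : R, 0 < eta ->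
  exists2 delta : R, 0 < delta &
    forall x y, A x -> A y -> `|x - y| < delta -> `|f x - f y| <= eta.
Proof.
move=> /compact_near_coveringP cA /subspace_continuousP cf eta eta0.
pose P (d : R) x := A x -> forall y, A y -> `|x - y| < d -> `|f x - f y| <= eta.
have H : \forall d \near (0 : R)^'+, A `<=` P d.
  apply: cA => x0 Ax0.
  have eta20 : 0 < eta / 2 by rewrite divr_gt0.
  have /cvgr_dist_lt /(_ _ eta20) := cf x0 Ax0.
  move=> /nbhs_ballP[e /= e0 He].
  have e20 : 0 < e / 2 by rewrite divr_gt0.
  exists (ball x0 (e / 2), [set d : R | d < e / 2]).
    by split; [exact: nbhsx_ballx|exact: nbhs_right_lt].
  move=> [x d] /= [x0x de] Ax y Ay xy.
  have xx0 : ball x0 e x by apply: le_ball x0x; lra.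
  have yx0 : ball x0 e y.
    move: x0x; rewrite -!ball_normE /= => x0x.
    rewrite -(subrKA x) (le_lt_trans (ler_normD _ _))//; lra.
  have := He _ xx0 Ax; have := He _ yx0 Ay => fy fx.
  rewrite -(subrKA (f x0)) (le_trans (ler_normD _ _))//.
  by rewrite (distrC (f x)); lra.
near (0 : R)^'+ => d; exists d; first by near: d; exact: nbhs_right_gt.
move=> x y Ax Ay xy; have AP : A `<=` P d by near: d.
exact: (AP x).
Unshelve. all: by end_near. Qed.

(** Pointwise decay at each boundary point becomes a uniform boundary layer
    by compactness of the closure. *)
Lemma boundary_layer (Omega : set 'rV[R]_N) rho (f : 'rV[R]_N -> R) (F M eta : R) :
  open Omega -> (forall x, Omega x -> `|x| <= rho) -> C2_boundary Omega ->
  (forall x, Omega x -> `|f x| <= F) -> 0 <= F -> 0 <= M ->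
  (forall eps u, 0 < eps < 1 -> solves sigma eps Omega f u ->
    forall x, `|u x| <= M) -> 0 < eta ->
  exists2 delta : R, 0 < delta & forall eps u, 0 < eps < 1 -> eps < delta ->
    solves sigma eps Omega f u ->
    forall x y, Omega x -> ~ Omega y -> `|x - y| < delta -> `|u x| <= eta.
Proof.
move=> oO Orho bO fF F0 M0 uM eta0.
have /compact_near_coveringP cO := compact_closure_bounded Orho.
pose P (d : R) x := Omega x -> forall y, ~ Omega y -> `|x - y| < d ->
  forall eps u, 0 < eps < 1 -> eps < d -> solves sigma eps Omega f u ->
  `|u x| <= eta.
have H : \forall d \near (0 : R)^'+, closure Omega `<=` P d.
  apply: cO => x0 cx0.
  have [Ox0|nOx0] := pselect (Omega x0).
    have /nbhs_ballP[e /= e0 eO] := open_nbhs_nbhs (conj oO Ox0).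
    have e20 : 0 < e / 2 by rewrite divr_gt0.
    exists (ball x0 (e / 2), [set d : R | d < e / 2]).
      by split; [exact: nbhsx_ballx|exact: nbhs_right_lt].
    move=> [x d] /= [x0x de] Ox y nOy xy; exfalso; apply: nOy; apply: eO.
    move: x0x; rewrite -!ball_normE /= => x0x.
    rewrite -(subrKA x) (le_lt_trans (ler_normD _ _))//; lra.
  have [c [r0 [c0 r00 ext]]] := C2_boundary_exterior_box oO bO cx0 nOx0.
  have [r rp dec] := boundary_decay sigma01 N_gt0 oO Orho c0 r00 ext F0 M0 eta0.
  exists (ball x0 r, [set d : R | d < r]).
    by split; [exact: nbhsx_ballx|exact: nbhs_right_lt].
  move=> [x d] /= [x0x dr] Ox y nOy xy eps u e01 ed su.
  have er : eps < r by lra.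
  have xr : `|x - x0| < r by move: x0x; rewrite -ball_normE /= distrC.
  rewrite ler_norml; apply/andP; split.
    rewrite lerNl; apply: (dec eps (fun x => - f x) (fun x => - u x)) => //.
    - by apply: solvesN => //; case/andP: e01.
    - by move=> z Oz; rewrite (le_trans (ler_norm _))// normrN fF.
    - by move=> z; rewrite (le_trans (ler_norm _))// normrN (uM eps).
  apply: (dec eps f u) => //.
  - by move=> z Oz; rewrite (le_trans (ler_norm _))// fF.
  - by move=> z; rewrite (le_trans (ler_norm _))// (uM eps).
near (0 : R)^'+ => d; exists d; first by near: d; exact: nbhs_right_gt.
move=> eps u e01 ed su x y Ox nOy xy.
have AP : closure Omega `<=` P d by near: d.
exact: (AP x (subset_closure Ox) Ox y nOy xy eps u).
Unshelve. all: by end_near. Qed.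

Lemma solutions_equicontinuous (Omega : set 'rV[R]_N) (f : 'rV[R]_N -> R) :
  bounded_domain Omega -> C2_boundary Omega -> {within closure Omega, continuous f} ->
  (exists2 M : R, 0 <= M & forall eps u, 0 < eps < 1 ->
    is_solution sigma eps Omega f u -> forall x, `|u x| <= M) /\
  forall eta : R, 0 < eta -> exists2 delta : R, 0 < delta &
    forall eps u, 0 < eps < 1 -> is_solution sigma eps Omega f u ->
    forall x y, Omega x -> Omega y -> `|x - y| < delta -> `|u x - u y| <= eta.
Proof.
move=> [oO _ _ [rho0 [_ bO]]] b2O cf.
have Orho x : Omega x -> `|x| <= rho0 + 1 by apply: bO; rewrite ltrDl.
have cO := compact_closure_bounded Orho.
have [F F0 fF] : exists2 F : R, 0 <= F & forall x, Omega x -> `|f x| <= F.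
  have /compact_bounded[F [_ HF]] := continuous_compact cf cO.
  exists (`|F| + 1); first by rewrite addr_ge0.
  move=> x Ox; apply: HF; first by rewrite (le_lt_trans (ler_norm _))// ltrDl.
  by exists x => //; exact: subset_closure.
have f_unif eta : 0 < eta -> exists2 delta : R, 0 < delta &
    forall x y, Omega x -> Omega y -> `|x - y| < delta -> `|f x - f y| <= eta.
  move=> eta0; have [d d0 Hd] := compact_uniformly_continuous cO cf eta0.
  by exists d => // x y Ox Oy; apply: Hd; exact: subset_closure.
have [M M0 uM] := solution_uniform_bound sigma01 N_gt0 Orho fF F0.
have sol eps u : 0 < eps < 1 -> is_solution sigma eps Omega f u ->
    solves sigma eps Omega f u.
  by move=> /andP[e0 _]; exact: is_solution_solves.
split; first by exists M => // eps u e01 /(sol _ _ e01); exact: uM.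
move=> eta eta0; have eta20 : 0 < eta / 2 by rewrite divr_gt0.
have [d0 d00 layer] := boundary_layer oO Orho b2O fF F0 M0 uM eta20.
have [d1 d10 small] := equicontinuity_small_eps sigma01 N_gt0 Orho f_unif
  eta0 d00 layer.
have [d2 d20 large] := equicontinuity_large_eps sigma01 N_gt0 Orho fF F0 f_unif
  d00 eta0.
exists (Num.min d1 d2); first by rewrite lt_min d10 d20.
move=> eps u e01 /(sol _ _ e01) su.
have key x y : Omega x -> Omega y -> `|x - y| < Num.min d1 d2 -> u x - u y <= eta.
  rewrite lt_min => Ox Oy /andP[xy1 xy2]; have [de|ed] := leP d0 eps.
    exact: (large eps u).
  exact: (small eps u).
move=> x y Ox Oy xy; rewrite ler_norml; apply/andP; split; last exact: key.
by rewrite lerNl opprB; apply: key => //; rewrite distrC.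
Qed.

End compactness.

Unset Implicit Arguments.

Theorem theorem1p1 (R : realType) (sigma : R) (hsigma : 0 < sigma < 1)
    (N : nat) (hN : (0 < N)%N)
    (Omega : set 'rV[R]_N)
    (domOmega : bounded_domain Omega) (C2Omega : C2_boundary Omega)
    (f : 'rV[R]_N -> R) (cf : {within closure Omega, continuous f}) :
  exists m : R -> R,
    modulus_of_continuity m /\
    forall (eps : R) (u : 'rV[R]_N -> R),
      0 < eps < 1 -> is_solution sigma eps Omega f u ->
      forall x y, Omega x -> Omega y -> `|u x - u y| <= m (enorm (x - y)).
Proof.
have [[M M0 uM] equi] := solutions_equicontinuous hsigma hN domOmega C2Omega cf.
(* The value [0] is added so that the set is nonempty even without solutions. *)
pose S (t : R) : set R := [set d | d = 0 \/ exists eps u x y,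
  [/\ 0 < eps < 1 /\ is_solution sigma eps Omega f u, Omega x, Omega y,
      enorm (x - y) <= t & d = `|u x - u y|]].
have S0 t : S t 0 by left.
have SM t : ubound (S t) (2 * M).
  move=> d [->|[eps [u [x [y [[e01 su] Ox Oy _ ->]]]]]]; first by rewrite mulr_ge0.
  rewrite (le_trans (ler_normB _ _))//.
  by have := uM eps u e01 su x; have := uM eps u e01 su y; lra.
have Ssup t : has_sup (S t) by split; [exists 0|exists (2 * M)].
have m_ge t d : S t d -> d <= sup (S t) by exact: sup_upper_bound.
have m_le t c : (forall d, S t d -> d <= c) -> sup (S t) <= c.
  by move=> H; apply: ge_sup => //; exists 0.
exists (fun t => sup (S t)); split; last first.
  move=> eps u e01 su x y Ox Oy; apply: m_ge; right.
  by exists eps, u, x, y; split.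
split.
- by move=> t _; exact: m_ge.
- move=> s t _ st; apply: m_le => d Sd; apply: m_ge.
  case: Sd => [->|[eps [u [x [y [esu Ox Oy xys ->]]]]]]; first by left.
  by right; exists eps, u, x, y; split => //; exact: le_trans xys st.
- apply/eqP; rewrite eq_le m_ge// andbT; apply: m_le => d [->//|].
  move=> [eps [u [x [y [_ _ _ xy0 ->]]]]].
  suff -> : x = y by rewrite subrr normr0.
  by apply/eqP; rewrite -subr_eq0 -normr_le0 (le_trans (norm_le_enorm _)).
- apply/cvgr0Pnorm_le => eta eta0; have [d d0 Hd] := equi _ eta0.
  near=> t; rewrite ger0_norm ?m_ge//; apply: m_le => d' [->|]; first exact: ltW.
  move=> [eps [u [x [y [[e01 su] Ox Oy xyt ->]]]]].
  apply: (Hd eps u) => //; rewrite (le_lt_trans (norm_le_enorm _))//.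
  by rewrite (le_lt_trans xyt)//; near: t; exact: nbhs_right_lt.
Unshelve. all: by end_near. Qed.
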